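(* Let $n\ge 1$, and let $\mu$ be the measure on $\mathbb R^n$ with density $e^{-|x|^2}$. Suppose that for every $r>0$, every simplex $S\subset\mathbb R^n$ containing the ball $B_0(r)$ satisfies $\mu(S)\ge\mu(S_0)$, where $S_0$ is a regular simplex with inscribed ball $B_0(r)$. Then for every $r>0$ the maximum of $P(v_1,\ldots,v_{n+1})$ over all $v_1,\ldots,v_{n+1}\in\mathbb R^n$ with $|v_1|=\dots=|v_{n+1}|=r$ is attained at any configuration forming the vertices of a regular simplex inscribed into the ball of radius $r$ centered at the origin.
   Context: $B_0(r)$ is the closed Euclidean ball of radius $r$ centered at the origin. A simplex in $\mathbb R^n$ here is an ordinary (bounded, $n$-dimensional) simplex. For vectors $v_1,\ldots,v_N\in\mathbb R^n$, $$P(v_1,\ldots,v_N)=\int_{\mathbb R^n}\max_{1\le i\le N} e^{-|x-v_i|^2}\,dx .$$ *)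

(* Defs.v *)
From HB Require Import structures.
From mathcomp Require Import all_boot all_order all_algebra.
From mathcomp Require Import all_classical all_reals all_analysis.

Set Implicit Arguments.
Unset Strict Implicit.
Unset Printing Implicit Defensive.

Import Order.TTheory GRing.Theory Num.Theory.
Import numFieldNormedType.Exports.

Local Open Scope classical_set_scope.
Local Open Scope ring_scope.

(* The library has no sigma-algebra on matrices: row vectors get the one
   generated by the coordinates, as [n.-tuple T] does. On ['rV[R]_n] with
   [R : realType] this is the Borel sigma-algebra. *)

Definition measure_rV_display : measure_display -> measure_display.
Proof. exact. Qed.

Section measurable_rV.
Context {d : measure_display} {T : sigmaRingType d}.
Variable n : nat.

Let coors : 'I_n -> 'rV[T]_n -> T := fun i x => x ord0 i.

Let rV_set0 : g_sigma_preimage coors set0.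
Proof. exact: sigma_algebra0. Qed.

Let rV_setC A : g_sigma_preimage coors A -> g_sigma_preimage coors (~` A).
Proof. exact: sigma_algebraC. Qed.

Let rV_bigcup (F : _^nat) : (forall i, g_sigma_preimage coors (F i)) ->
  g_sigma_preimage coors (\bigcup_i (F i)).
Proof. exact: sigma_algebra_bigcup. Qed.

HB.instance Definition _ := @isMeasurable.Build (measure_rV_display d)
  'rV[T]_n (g_sigma_preimage coors) rV_set0 rV_setC rV_bigcup.

End measurable_rV.

Lemma measurable_coord_rV d (T : sigmaRingType d) n (i : 'I_n) :
  measurable_fun [set: 'rV[T]_n] (fun x => x ord0 i).
Proof.
move=> _ Y mY; rewrite setTI; apply: sub_sigma_algebra => /=.
rewrite -bigcup_seq/=; exists i => /=; first by rewrite mem_index_enum.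
by exists Y => //; rewrite setTI.
Qed.

Lemma measurable_fun_rVP d1 d2 (T1 : measurableType d1)
    (T2 : measurableType d2) n (f : T1 -> 'rV[T2]_n) :
  measurable_fun [set: T1] f <->
  forall i, measurable_fun [set: T1] (fun x => f x ord0 i).
Proof.
split=> [mf i|mf].
  apply: (@measurableT_comp _ _ _ _ _ _ (fun x : 'rV[T2]_n => x ord0 i)) mf.
  exact: measurable_coord_rV.
move=> _ A mA; rewrite setTI.
suff: (@measurable _ 'rV[T2]_n) `<=` [set A | measurable (f @^-1` A)] by move/(_ A mA).
apply: smallest_sub.
  split => /=.
  - by rewrite preimage_set0.
  - by move=> B mB; rewrite setTD preimage_setC; exact: measurableC.
  - by move=> F mF; rewrite preimage_bigcup; exact: bigcup_measurable.
move=> B; rewrite -bigcup_seq/= => -[i _ [C mC <-]].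
by rewrite setTI /= -[X in measurable X]setTI; exact: (mf i).
Qed.

Section lebesgue_rV.
Context {R : realType}.
Local Open Scope ereal_scope.

Definition cons_rV n (p : measurableTypeR R * 'rV[R]_n) : 'rV[R]_n.+1 :=
  \row_i (if unlift ord0 i is Some j then p.2 ord0 j else p.1).

Definition uncons_rV n (x : 'rV[R]_n.+1) : measurableTypeR R * 'rV[R]_n :=
  (x ord0 ord0, \row_i x ord0 (lift ord0 i)).

(* Lebesgue measure on [R^n], as an iterated product measure; see
   [lebesgue_rV_box] for its characteristic property. *)
Fixpoint lebesgue_rV n : set 'rV[R]_n -> \bar R :=
  match n with
  | 0 => \d_(0%R : 'rV[R]_0)
  | m.+1 => pushforward (lebesgue_measure \x lebesgue_rV (n := m))
              (@cons_rV m)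
  end.

Lemma measurable_cons_rV n : measurable_fun setT (@cons_rV n).
Proof.
apply/measurable_fun_rVP => i.
case: (unliftP ord0 i) => [j|] ->.
  apply: (eq_measurable_fun (fun x : measurableTypeR R * 'rV[R]_n => x.2 ord0 j)).
    by move=> x _; rewrite mxE liftK.
  apply: (@measurableT_comp _ _ _ _ _ _ (fun x : 'rV[R]_n => x ord0 j)).
    exact: measurable_coord_rV.
  exact: measurable_snd.
apply: (eq_measurable_fun fst); last exact: measurable_fst.
by move=> x _; rewrite mxE unlift_none.
Qed.

Lemma measurable_uncons_rV n : measurable_fun setT (@uncons_rV n).
Proof.
apply: measurable_fun_pair; first exact: measurable_coord_rV.
apply/measurable_fun_rVP => i.
apply: (eq_measurable_fun (fun x : 'rV[R]_n.+1 => x ord0 (lift ord0 i))).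
  by move=> x _; rewrite mxE.
exact: measurable_coord_rV.
Qed.

Lemma cons_rVK n : cancel (@cons_rV n) (@uncons_rV n).
Proof.
move=> [a v]; congr pair; first by rewrite mxE unlift_none.
by apply/rowP => i; rewrite !mxE liftK.
Qed.

Lemma uncons_rVK n : cancel (@uncons_rV n) (@cons_rV n).
Proof.
move=> v; apply/rowP => i; rewrite mxE.
by case: unliftP => [j ->|-> //]; rewrite mxE.
Qed.




Let lebesgue_rV_measure n :
  exists m : {sigma_finite_measure set 'rV[R]_n -> \bar R},
    m = @lebesgue_rV n :> (set _ -> _).
Proof.
elim: n => [|n [m mE]]; first by exists \d_(0%R : 'rV[R]_0).
pose p := [the {measure set _ -> \bar R} of lebesgue_measure \x m].
have mc := @measurable_cons_rV n.
pose q := @pushforward _ _ _ 'rV[R]_n.+1 R p (@cons_rV n).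
have q0 : q set0 = 0 by exact: measure0.
have q_ge0 A : 0 <= q A by exact: measure_ge0.
have q_add : semi_sigma_additive q by exact: measure_semi_sigma_additive.
have sq : sigma_finite setT q.
  have /sigma_finiteP[F [FT ndF Foo]] := sigma_finiteT (@lebesgue_measure R).
  have /sigma_finiteP[G [GT ndG Goo]] := sigma_finiteT m.
  exists (fun k => @uncons_rV n @^-1` (F k `*` G k)).
    rewrite -preimage_bigcup (_ : \bigcup_k _ = setT) ?preimage_setT//.
    rewrite -subTset => -[a v] _.
    have [k _ Fka] : (\bigcup_k F k) a by rewrite -FT.
    have [l _ Glv] : (\bigcup_k G k) v by rewrite -GT.
    exists (maxn k l) => //; split => /=.
    - by move: Fka; exact/subsetPset/ndF/leq_maxl.
    - by move: Glv; exact/subsetPset/ndG/leq_maxr.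
  move=> k; have [mF Fk] := Foo k; have [mG Gk] := Goo k; split.
    rewrite -[X in measurable X]setTI.
    by apply: measurable_uncons_rV => //; exact: measurableX.
  rewrite /q/= /pushforward -comp_preimage.
  rewrite (_ : _ \o _ = id); last by apply/funext => x /=; exact: cons_rVK.
  by rewrite preimage_id product_measure1E// lte_mul_pinfty// ge0_fin_numE.
pose s := HB.pack_for {sigma_finite_measure set 'rV[R]_n.+1 -> \bar R}
  q
  (isMeasure.Build _ _ _ q q0 q_ge0 q_add) (Measure_isSigmaFinite.Build _ _ _ q sq).
by exists (s mc mc mc); rewrite /= -mE.
Qed.

Let lebesgue_rV0 n : @lebesgue_rV n set0 = 0.
Proof. by have [m <-] := lebesgue_rV_measure n; exact: measure0. Qed.

Let lebesgue_rV_ge0 n A : 0 <= @lebesgue_rV n A.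
Proof. by have [m <-] := lebesgue_rV_measure n; exact: measure_ge0. Qed.

Let lebesgue_rV_semi_sigma_additive n : semi_sigma_additive (@lebesgue_rV n).
Proof.
have [m <-] := lebesgue_rV_measure n; exact: measure_semi_sigma_additive.
Qed.

HB.instance Definition _ n := isMeasure.Build _ _ _ (@lebesgue_rV n)
  (lebesgue_rV0 n) (@lebesgue_rV_ge0 n) (@lebesgue_rV_semi_sigma_additive n).

Let lebesgue_rV_sigma_finite n : sigma_finite setT (@lebesgue_rV n).
Proof. by have [m <-] := lebesgue_rV_measure n; exact: sigma_finiteT. Qed.

HB.instance Definition _ n := Measure_isSigmaFinite.Build _ _ _ (@lebesgue_rV n)
  (@lebesgue_rV_sigma_finite n).

Lemma lebesgue_rV_box n (I : 'I_n -> set R) :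
  (forall i, measurable (I i)) ->
  lebesgue_rV [set x : 'rV[R]_n | forall i, I i (x ord0 i)] =
  \prod_(i < n) lebesgue_measure (I i).
Proof.
elim: n I => [|n ih] I mI.
  by rewrite big_ord0 /= diracE mem_set// => -[].
rewrite big_ord_recl /= /pushforward -ih//.
rewrite -product_measure1E; [|exact: mI|]; last first.
  rewrite (_ : [set x | _] =
      \bigcap_(i in [set: 'I_n])
        [set x : 'rV[R]_n | I (lift ord0 i) (x ord0 i)]).
    apply: fin_bigcap_measurable => // i _; rewrite -[X in measurable X]setTI.
    exact: (measurable_coord_rV (i : 'I_n) measurableT (mI (lift ord0 i))).
  by apply/seteqP; split => x /= Ix => [i _|i]; exact: Ix.
congr (product_measure1 _ _ _); apply/seteqP; split => -[a v] /= Iav.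
  split => [|i]; first by have := Iav ord0; rewrite /cons_rV mxE unlift_none.
  by have := Iav (lift ord0 i); rewrite mxE liftK.
by move=> i; rewrite mxE; case: unliftP => [j ->|->]; case: Iav.
Qed.

End lebesgue_rV.

Section defs.
Context {R : realType}.

(* The library norm on ['rV[R]_n] is the sup norm. *)
Definition enorm n (x : 'rV[R]_n) : R := Num.sqrt (\sum_(i < n) x ord0 i ^+ 2).

Definition eball n (r : R) : set 'rV[R]_n := [set x | enorm x <= r].

Definition conv_hull n k (w : 'I_k -> 'rV[R]_n) : set 'rV[R]_n :=
  [set x | exists a : 'I_k -> R,
     [/\ forall i, 0 <= a i, \sum_(i < k) a i = 1 &
         x = \sum_(i < k) a i *: w i]].

Definition affinely_independent n k (w : 'I_k -> 'rV[R]_n) : Prop :=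
  forall a : 'I_k -> R,
    \sum_(i < k) a i = 0 -> \sum_(i < k) a i *: w i = 0 -> forall i, a i = 0.

(* Affine independence of the [n.+1] vertices makes the simplex
   [n]-dimensional. *)
Definition is_simplex n (S : set 'rV[R]_n) : Prop :=
  exists w : 'I_n.+1 -> 'rV[R]_n, affinely_independent w /\ S = conv_hull w.

Definition facet n (w : 'I_n.+1 -> 'rV[R]_n) (i : 'I_n.+1) : set 'rV[R]_n :=
  conv_hull (fun j : 'I_n => w (lift i j)).

Definition regular_simplex n (w : 'I_n.+1 -> 'rV[R]_n) : Prop :=
  affinely_independent w /\
  forall i j k l, i != j -> k != l -> enorm (w i - w j) = enorm (w k - w l).

(* A ball contained in the simplex and meeting each facet is tangent to all
   facets. *)
Definition inscribed_ball n (r : R) (w : 'I_n.+1 -> 'rV[R]_n) : Prop :=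
  eball r `<=` conv_hull w /\ forall i, facet w i `&` eball r !=set0.

Definition gauss n (A : set 'rV[R]_n) : \bar R :=
  (\int[@lebesgue_rV R n]_(x in A) (expR (- enorm x ^+ 2))%:E)%E.

(* The terms of the maximum are positive, so the default value [0] only
   matters for the empty family. *)
Definition max_gauss n N (v : 'I_N -> 'rV[R]_n) : \bar R :=
  (\int[@lebesgue_rV R n]_x
     (\big[Num.max/0%R]_(i < N) expR (- enorm (x - v i) ^+ 2))%:E)%E.

End defs.

(* Main.v *)
Require Import Defs.
From mathcomp Require Import all_boot all_order all_algebra.
From mathcomp Require Import all_classical all_reals all_analysis.
From mathcomp Require Import measurable_realfun ring lra.

(** For points [v i] of norm [r], expanding the square turns the maximum of the
    Gaussians into [expR (- r^2) * expR (- |x|^2) * expR (2 * max_i <x, v i>)], so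
    with the measure [mu] of density [expR (- |x|^2)] one has to maximize
    [Q v = \int expR (2 * max_i <x, v i>) d mu].

    The sublevel sets of [max_i <x, v i>] are the intersections of half-spaces
    [{x | <x, v i> <= s}].  If the [v i] span the space, are positively dependent
    and have norm at most [r], this is for [s > 0] a simplex that contains the ball
    of radius [s / r]; for a regular [w] it is the regular simplex with that
    inscribed ball.  The hypothesis compares the measures level by level, and the
    layer cake formula gives [Q v <= Q w].  By approximation the inequality
    persists as soon as the origin lies in the convex hull of the [v i].

    In general, let [x] be one of the points and [W] the others.  Moving [x] to a
    point [t] of the same norm with [<t, y> <= <x, y>] for all [y] in [W] does not
    decrease [Q]: polarize with respect to the reflection that exchanges [x] and
    [t].  One can always choose such a [t] in minus the cone generated by [W], unless
    the convex hull of [W] already contains the origin. *)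

Import Order.TTheory GRing.Theory Num.Theory.
Import numFieldNormedType.Exports.
Local Open Scope classical_set_scope.
Local Open Scope ring_scope.

Set Implicit Arguments.
Unset Strict Implicit.

(** * Euclidean geometry *)

Lemma sum_delta_scale {R : pzRingType} {V : lmodType R} k (j : 'I_k) (f : 'I_k -> V) :
  \sum_i (i == j)%:R *: f i = f j.
Proof.
rewrite (bigD1 j)//= eqxx scale1r big1 ?addr0// => i /negbTE ->.
by rewrite scale0r.
Qed.

Lemma sum_delta {R : pzRingType} k (j : 'I_k) : \sum_i (i == j)%:R = 1 :> R.
Proof. by rewrite (bigD1 j)//= eqxx big1 ?addr0// => i /negbTE ->. Qed.

Definition dot {R : realType} n (x y : 'rV[R]_n) : R :=
  \sum_(i < n) x ord0 i * y ord0 i.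

Section dot.
Context {R : realType} {n : nat}.
Implicit Types x y z : 'rV[R]_n.

Lemma dotC x y : dot x y = dot y x.
Proof. by apply: eq_bigr => i _; rewrite mulrC. Qed.

Lemma dotDl x y z : dot (x + y) z = dot x z + dot y z.
Proof. by rewrite -big_split; apply: eq_bigr => i _; rewrite mxE mulrDl. Qed.

Lemma dotDr x y z : dot z (x + y) = dot z x + dot z y.
Proof. by rewrite dotC dotDl !(dotC z). Qed.

Lemma dotZl a x y : dot (a *: x) y = a * dot x y.
Proof. by rewrite mulr_sumr; apply: eq_bigr => i _; rewrite mxE mulrA. Qed.

Lemma dotZr a x y : dot x (a *: y) = a * dot x y.
Proof. by rewrite dotC dotZl dotC. Qed.

Lemma dotNl x y : dot (- x) y = - dot x y.
Proof. by rewrite -scaleN1r dotZl mulN1r. Qed.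

Lemma dotNr x y : dot x (- y) = - dot x y.
Proof. by rewrite dotC dotNl dotC. Qed.

Lemma dot0l x : dot 0 x = 0.
Proof. by rewrite -(scale0r 0) dotZl mul0r. Qed.

Lemma dot0r x : dot x 0 = 0.
Proof. by rewrite dotC dot0l. Qed.

Definition dotE := (dotDl, dotDr, dotNl, dotNr, dotZl, dotZr, dot0l, dot0r).

Lemma dot_suml (I : Type) (s : seq I) (P : pred I) (F : I -> 'rV[R]_n) y :
  dot (\sum_(i <- s | P i) F i) y = \sum_(i <- s | P i) dot (F i) y.
Proof. by elim/big_rec2 : _ => [|i a b _ <-]; rewrite ?dot0l ?dotDl. Qed.

Lemma dot_sumr (I : Type) (s : seq I) (P : pred I) (F : I -> 'rV[R]_n) y :
  dot y (\sum_(i <- s | P i) F i) = \sum_(i <- s | P i) dot y (F i).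
Proof. by rewrite dotC dot_suml; apply: eq_bigr => i _; rewrite dotC. Qed.

Lemma dot_ge0 x : 0 <= dot x x.
Proof. by apply: sumr_ge0 => i _; rewrite -expr2 sqr_ge0. Qed.

Lemma dot_eq0 x : (dot x x == 0) = (x == 0).
Proof.
apply/idP/eqP => [|->]; last by rewrite dot0l.
rewrite psumr_eq0 => [/allP x0|i _]; last by rewrite -expr2 sqr_ge0.
apply/rowP => i; rewrite mxE; apply/eqP.
by have := x0 i; rewrite mem_index_enum mulf_eq0 orbb; exact.
Qed.

Lemma dot_gt0 x : (0 < dot x x) = (x != 0).
Proof. by rewrite lt0r dot_eq0 dot_ge0 andbT. Qed.

(** Cauchy-Schwarz, from the square norm of [dot y y *: x - dot x y *: y], which has the factor
    [dot y y]. *)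
Lemma dot_sqr_le x y : dot x y ^+ 2 <= dot x x * dot y y.
Proof.
have [->|y0] := eqVneq y 0; first by rewrite !dotE expr0n mulr0.
have yy : 0 < dot y y by rewrite dot_gt0.
have := dot_ge0 (dot y y *: x - dot x y *: y).
rewrite !dotE (dotC y x).
rewrite [X in 0 <= X](_ : _ = dot y y * (dot x x * dot y y - dot x y ^+ 2)); last by ring.
by rewrite pmulr_rge0// subr_ge0.
Qed.

Lemma enorm_sqr x : enorm x ^+ 2 = dot x x.
Proof. by rewrite sqr_sqrtr//; apply: sumr_ge0 => i _; rewrite sqr_ge0. Qed.

Lemma enorm_ge0 x : 0 <= enorm x.
Proof. exact: sqrtr_ge0. Qed.

Lemma enormE x : enorm x = Num.sqrt (dot x x).
Proof. by []. Qed.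

Lemma enorm_sqr_le x (r : R) : 0 <= r -> (enorm x <= r) = (dot x x <= r ^+ 2).
Proof. by move=> r0; rewrite -enorm_sqr ler_pXn2r// nnegrE enorm_ge0. Qed.

Lemma dot_le_enorm x y : dot x y <= enorm x * enorm y.
Proof.
rewrite (le_trans (ler_norm _))// -(ler_pXn2r (n:=2))// ?nnegrE ?mulr_ge0 ?enorm_ge0//.
by rewrite real_normK ?num_real// exprMn !enorm_sqr dot_sqr_le.
Qed.

Lemma enormD x y : enorm (x + y) <= enorm x + enorm y.
Proof.
rewrite enorm_sqr_le ?addr_ge0 ?enorm_ge0// !dotE (dotC y x).
have := dot_le_enorm x y; rewrite sqrrD !enorm_sqr; lra.
Qed.

Lemma enormZ a x : enorm (a *: x) = `|a| * enorm x.
Proof. by rewrite !enormE !dotE mulrA -expr2 sqrtrM ?sqr_ge0// sqrtr_sqr. Qed.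

Lemma enormN x : enorm (- x) = enorm x.
Proof. by rewrite -scaleN1r enormZ normrN1 mul1r. Qed.

Lemma enorm0 : enorm (0 : 'rV[R]_n) = 0.
Proof. by rewrite enormE dot0l sqrtr0. Qed.

Lemma enorm_sum (I : Type) (s : seq I) (P : pred I) (F : I -> 'rV[R]_n) :
  enorm (\sum_(i <- s | P i) F i) <= \sum_(i <- s | P i) enorm (F i).
Proof.
elim/big_rec2 : _ => [|i a b _ ab]; first by rewrite enorm0.
by rewrite (le_trans (enormD _ _))// lerD2l.
Qed.

End dot.

(** * Simplices cut out by half-spaces *)

Definition halfspaces {R : realType} n k (v : 'I_k -> 'rV[R]_n) (s : R) :
  set 'rV[R]_n := [set x | forall i, dot x (v i) <= s].

Definition spanning {R : realType} n k (v : 'I_k -> 'rV[R]_n) : Prop :=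
  forall x, (forall i, dot x (v i) = 0) -> x = 0.

Section polar_simplex.
Context {R : realType} {n : nat}.
Variables (v : 'I_n.+1 -> 'rV[R]_n) (a : 'I_n.+1 -> R).
Hypothesis a_gt0 : forall i, 0 < a i.
Hypothesis a_sum : \sum_i a i = 1.
Hypothesis av0 : \sum_i a i *: v i = 0.
Hypothesis vspan : spanning v.

Let dot_inj (x y : 'rV[R]_n) :
  (forall j, dot x (v j) = dot y (v j)) -> x = y.
Proof.
by move=> xy; apply/subr0_eq/vspan => i; rewrite !dotE xy subrr.
Qed.

(** The vertex [p i] lies on every hyperplane [dot x (v j) = s] with [j != i]; its product with
    [v i] is then forced by the relation [\sum_j a j *: v j = 0]. *)
Definition polar_vertices (s : R) (p : 'I_n.+1 -> 'rV[R]_n) : Prop :=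
  forall i j, dot (p i) (v j) = s - (i == j)%:R * (s / a i).

(** Since [v] spans, the map from [x] to the row of the [dot x (v j)] is injective. Its image has
    dimension [n], hence is the whole hyperplane of rows [y] with [\sum_j a j * y j = 0], which
    contains the prescribed rows. *)
Lemma polar_vertices_exist s : exists p, polar_vertices s p.
Proof.
pose V : 'M[R]_(n, n.+1) := \matrix_(i, j) v j ord0 i.
have dotV (x : 'rV[R]_n) j : (x *m V) ord0 j = dot x (v j).
  by rewrite mxE; apply: eq_bigr => i _; rewrite mxE.
pose A : 'cV[R]_n.+1 := \col_i a i.
have rV : row_free V.
  apply/inj_row_free => x /rowP xV; apply: vspan => i.
  by have := xV i; rewrite dotV mxE.
have rA : \rank A = 1%N.
  have : A != 0.
    apply/eqP => /matrixP/(_ ord0 ord0); rewrite !mxE => /eqP.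
    by rewrite gt_eqF.
  by rewrite -mxrank_eq0; have := rank_leq_col A; case: (\rank A) => [|[]].
have VA : V *m A = 0.
  apply/matrixP => i j; rewrite !mxE.
  have /rowP/(_ i) := av0; rewrite summxE !mxE => {2}<-.
  by apply: eq_bigr => k _; rewrite !mxE mulrC.
have VK : (kermx A <= V)%MS.
  have : (V <= kermx A)%MS by apply/sub_kermxP.
  move=> /mxrank_leqif_sup/geq_leqif <-.
  by rewrite mxrank_ker rA (eqP rV) subn1.
suff H i : exists q : 'rV[R]_n, forall j, dot q (v j) = s - (i == j)%:R * (s / a i).
  by exists (fun i => proj1_sig (cid (H i))) => i j; case: cid.
pose y : 'rV[R]_n.+1 := \row_j (s - (i == j)%:R * (s / a i)).
have /submx_trans/(_ VK)/submxP[q yq] : (y <= kermx A)%MS.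
  apply/sub_kermxP/matrixP => j k; rewrite !mxE.
  under eq_bigr do rewrite !mxE mulrBl -mulrA.
  rewrite sumrB -mulr_sumr a_sum mulr1 (bigD1 i)//= eqxx mul1r big1.
    by rewrite addr0 mulfVK ?subrr// gt_eqF.
  by move=> l li; rewrite eq_sym (negbTE li) mul0r.
by exists q => j; rewrite -dotV -yq mxE.
Qed.

Variables (s : R) (p : 'I_n.+1 -> 'rV[R]_n).
Hypothesis s_gt0 : 0 < s.
Hypothesis pv : polar_vertices s p.

Let dot_sum_p (c : 'I_n.+1 -> R) j :
  dot (\sum_i c i *: p i) (v j) = s * \sum_i c i - c j * (s / a j).
Proof.
rewrite dot_suml; under eq_bigr do rewrite dotZl pv mulrBr.
rewrite sumrB mulrC mulr_suml; congr (_ - _).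
rewrite (bigD1 j)//= eqxx mul1r big1 ?addr0//.
by move=> i ij; rewrite (negbTE ij) mul0r mulr0.
Qed.

Lemma polar_vertices_affinely_independent : affinely_independent p.
Proof.
move=> c c0 cp j; have := dot_sum_p c j.
rewrite cp dot0l c0 mulr0 add0r => /esym/eqP; rewrite oppr_eq0 mulf_eq0.
by case/orP => /eqP// /eqP; rewrite gt_eqF// divr_gt0.
Qed.

(** The barycentric coordinates of [x] are the normalized slacks [a i * (s - dot x (v i)) / s]; the
    relation among the [v i] makes them sum to [1]. Equality of points is tested against the
    spanning family [v]. *)
Lemma halfspaces_conv_hull : halfspaces v s = conv_hull p.
Proof.
apply/seteqP; split => x.
  move=> xv; exists (fun i => a i * (s - dot x (v i)) / s).
  have sumE : \sum_i a i * (s - dot x (v i)) / s = 1.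
    under eq_bigr do rewrite mulrBr mulrBl.
    rewrite sumrB -!mulr_suml a_sum mul1r divff ?gt_eqF//.
    under eq_bigr do rewrite -dotZr.
    by rewrite -dot_sumr av0 dot0r mul0r subr0.
  split => [i|//|].
    apply: divr_ge0; last exact: ltW.
    by apply: mulr_ge0; [exact: ltW|rewrite subr_ge0; exact: xv].
  apply: dot_inj => j; rewrite dot_sum_p sumE mulr1.
  have s0 : s != 0 by rewrite gt_eqF.
  have aj : a j != 0 by rewrite gt_eqF.
  by field; rewrite s0 aj.
move=> [b [b0 b1 ->]] i; rewrite dot_sum_p b1 mulr1 gerBl.
by rewrite mulr_ge0// ltW// divr_gt0.
Qed.

End polar_simplex.

Lemma eball_halfspaces {R : realType} n k (v : 'I_k -> 'rV[R]_n) (r s : R) :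
  0 < r -> 0 <= s -> (forall i, enorm (v i) <= r) ->
  eball (s / r) `<=` halfspaces v s.
Proof.
move=> r0 s0 vr x xs i; rewrite (le_trans (dot_le_enorm _ _))//.
have -> : s = s / r * r by rewrite mulfVK// gt_eqF.
by rewrite ler_pM ?enorm_ge0.
Qed.

(** * Regular simplices centered at the origin *)

Section regular.
Context {R : realType} {n : nat}.
Variables (w : 'I_n.+1 -> 'rV[R]_n) (r : R).
Hypotheses (n_gt0 : (0 < n)%N) (r_gt0 : 0 < r).
Hypothesis w_regular : regular_simplex w.
Hypothesis w_norm : forall i, enorm (w i) = r.

Let w_dot i : dot (w i) (w i) = r ^+ 2.
Proof. by rewrite -enorm_sqr w_norm. Qed.

Let i1 : 'I_n.+1 := inord 1.

Let i10 : i1 != ord0.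
Proof. by rewrite -val_eqE /= inordK. Qed.

(** By equal norms and equal edges, this is the inner product of any two distinct vertices. *)
Let k := dot (w ord0) (w i1).

Let w_dotN i j : i != j -> dot (w i) (w j) = k.
Proof.
move=> ij; have [_ /(_ i j ord0 i1 ij)] := w_regular.
rewrite eq_sym => /(_ i10)/(congr1 (fun x => x ^+ 2)).
rewrite !enorm_sqr !dotE !w_dot (dotC (w j)) (dotC (w i1)) -/k; lra.
Qed.

Let k_lt : k < r ^+ 2.
Proof.
have w01 : w ord0 - w i1 != 0.
  apply/eqP => w01; have [/(_ (fun i => (i == ord0)%:R - (i == i1)%:R)) wi _] := w_regular.
  have := wi _ _ ord0; rewrite eqxx eq_sym (negbTE i10) subr0 => H.
  suff : (1 : R) = 0 by move/eqP; rewrite oner_eq0.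
  apply: H.
    by rewrite sumrB !sum_delta subrr.
  by under eq_bigr do rewrite scalerBl; rewrite sumrB !sum_delta_scale.
move: w01; rewrite -dot_gt0 !dotE !w_dot (dotC (w i1)) -/k; lra.
Qed.

(** In dimension [n], [n.+1] vectors satisfy a nontrivial linear relation [a]. Pairing it with [w j]
    shows that [a j * (r ^+ 2 - k)] does not depend on [j]; as [k < r ^+ 2], all coefficients
    coincide and can be divided out. *)
Lemma regular_simplex_sum0 : \sum_i w i = 0.
Proof.
pose W : 'M[R]_(n.+1, n) := \matrix_(i, j) w i ord0 j.
have [a aW a0] : exists2 a : 'rV_n.+1, a *m W = 0 & a != 0.
  have : kermx W != 0.
    rewrite -mxrank_eq0 mxrank_ker -lt0n subn_gt0 ltnS.
    exact: rank_leq_col.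
  by move=> /rowV0Pn[a /sub_kermxP aW a0]; exists a.
have aw0 : \sum_i a ord0 i *: w i = 0.
  rewrite -[RHS]aW; apply/rowP => j.
rewrite summxE !mxE.
  by apply: eq_bigr => i _; rewrite !mxE.
have aE j : a ord0 j * (r ^+ 2 - k) = - (k * \sum_i a ord0 i).
  have := congr1 (dot (w j)) aw0; rewrite dot0r dot_sumr (bigD1 j)//= dotZr w_dot.
  under eq_bigr => i ij do rewrite dotZr w_dotN 1?eq_sym//.
  rewrite -mulr_suml [in X in _ -> X](bigD1 j)//= => /eqP.
  by rewrite addr_eq0 => /eqP; rewrite mulrBr => ->; ring.
have aj j : a ord0 j = a ord0 ord0.
  apply: (mulIf (x := r ^+ 2 - k)); first by rewrite gt_eqF// subr_gt0.
  by rewrite !aE.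
have a00 : a ord0 ord0 != 0.
  by apply: contra_neq a0 => a0; apply/rowP => j; rewrite aj a0 mxE.
apply: (scalerI a00); rewrite scaler0 scaler_sumr -[RHS]aw0.
by apply: eq_bigr => j _; rewrite aj.
Qed.

Let kE : r ^+ 2 + n%:R * k = 0.
Proof.
rewrite -[RHS](dot0r (w ord0)) -regular_simplex_sum0 dot_sumr big_ord_recl w_dot.
congr (_ + _); under eq_bigr do rewrite w_dotN//.
by rewrite sumr_const card_ord mulr_natl.
Qed.

(** By affine independence the square matrix with rows [(1, w i)] is invertible. The row [(0, x)] is
    orthogonal to all of them, so it vanishes. *)
Lemma regular_simplex_spanning : spanning w.
Proof.
move=> x xw; have [wi _] := w_regular.
pose A : 'M[R]_(n.+1, 1 + n) := row_mx (const_mx 1) (\matrix_(i, j) w i ord0 j).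
have fA : row_free A.
  apply/inj_row_free => a; rewrite mul_mx_row -[X in _ = X]row_mx0.
  move=> /eq_row_mx[a1 aw]; apply/rowP => j; rewrite mxE; apply: wi => //.
    have /matrixP/(_ ord0 ord0) := a1; rewrite !mxE => a10.
    by rewrite -[RHS]a10; apply: eq_bigr => i _; rewrite mxE mulr1.
  rewrite -[RHS]aw; apply/rowP => l; rewrite summxE !mxE.
  by apply: eq_bigr => i _; rewrite !mxE.
have : A^T \in unitmx by rewrite unitmx_tr -row_free_unit.
pose y : 'rV[R]_(1 + n) := row_mx 0 x.
move=> /mulmxK/(_ y) /=; have -> : y *m A^T = 0.
  rewrite /y tr_row_mx mul_row_col mul0mx add0r; apply/rowP => i.
  by rewrite !mxE -[RHS](xw i); apply: eq_bigr => j _; rewrite !mxE.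
by rewrite mul0mx /y -[LHS]row_mx0 => /eq_row_mx[].
Qed.

(** By [kE] distinct vertices have inner product [- r ^+ 2 / n], so this factor yields the polar
    vertices for the uniform weights [1 / (n + 1)]. *)
Definition regular_polar (s : R) i : 'rV[R]_n := - (n%:R * s / r ^+ 2) *: w i.

Let n_neq0 : n%:R != 0 :> R. Proof. by rewrite pnatr_eq0 -lt0n. Qed.

Let r_neq0 : r != 0. Proof. by rewrite gt_eqF. Qed.

Lemma regular_polar_vertices s :
  polar_vertices w (fun=> n.+1%:R^-1) s (regular_polar s).
Proof.
have nk : n%:R * k = - r ^+ 2 by have := kE; lra.
have n1 : n%:R + 1 != 0 :> R by rewrite natr1 pnatr_eq0.
move=> i j; rewrite dotZl invrK -natr1; case: eqVneq => [->|ij] /=.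
  by rewrite w_dot; field.
rewrite w_dotN// mul0r subr0; transitivity (- (s * (n%:R * k) / r ^+ 2)).
  by ring.
by rewrite nk; field.
Qed.

Lemma regular_polar_regular s : 0 < s -> regular_simplex (regular_polar s).
Proof.
move=> s0; split.
  apply: (@polar_vertices_affinely_independent _ _ w (fun=> n.+1%:R^-1) _ s).
  - by move=> i; rewrite invr_gt0.
  - by [].
  - exact: regular_polar_vertices.
move=> i j h l ij hl; rewrite -!scalerBr !enormZ.
by have [_ /(_ i j h l ij hl) ->] := w_regular.
Qed.

Lemma regular_polar_inscribed s : 0 < s ->
  inscribed_ball (s / r) (regular_polar s).
Proof.
move=> s0; split.
  rewrite -(@halfspaces_conv_hull _ _ w (fun=> n.+1%:R^-1) _ _ _ _ s)//.
  - by apply: eball_halfspaces => //; [exact: ltW|move=> i; rewrite w_norm].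
  - by rewrite sumr_const card_ord -[LHS]mulr_natr mulVf// pnatr_eq0.
  - by rewrite -scaler_sumr regular_simplex_sum0 scaler0.
  - exact: regular_simplex_spanning.
  - exact: regular_polar_vertices.
(* The point of tangency with the facet opposite vertex [i] is the barycenter of that facet; as the
   [w j] sum to zero, it is a positive multiple of [w i], of norm [s / r]. *)
move=> i; exists (s / r ^+ 2 *: w i); split.
  exists (fun=> n%:R^-1); split => [j||].
  - by rewrite invr_ge0.
  - by rewrite sumr_const card_ord -[LHS]mulr_natr mulVf.
  have := regular_simplex_sum0; rewrite (bigD1_ord i)//= => /eqP.
  rewrite addr_eq0 => /eqP ->; rewrite -!scaler_sumr !scalerA scalerN -scaleNr.
  by congr (_ *: _); field; rewrite r_neq0.
rewrite /eball/= enormZ w_norm gtr0_norm ?divr_gt0 ?exprn_gt0//.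
by rewrite le_eqVlt; apply/orP; left; apply/eqP; field.
Qed.

End regular.

(** * Moving points *)

Section continuity.
Context {R : realType} {T : topologicalType}.

Lemma continuous_sum_ord k (F : 'I_k -> T -> R) :
  (forall i, continuous (F i)) -> continuous (fun x => \sum_i F i x).
Proof.
by move=> cF; apply: continuous_big => [|i _]; [exact: add_continuous|exact: cF].
Qed.

Lemma continuous_mul (f g : T -> R) :
  continuous f -> continuous g -> continuous (fun x => f x * g x).
Proof. by move=> cf cg x; exact: cvgM (cf x) (cg x). Qed.

Lemma continuous_add (f g : T -> R) :
  continuous f -> continuous g -> continuous (fun x => f x + g x).
Proof. by move=> cf cg x; apply: cvgD; [exact: cf|exact: cg]. Qed.

End continuity.

Lemma dot_comb {R : realType} n k (c : 'I_k -> R) (W : 'I_k -> 'rV[R]_n) y :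
  dot (\sum_j c j *: W j) y = \sum_j c j * dot (W j) y.
Proof. by rewrite dot_suml; apply: eq_bigr => j _; rewrite dotZl. Qed.

Lemma linear_term_ge0 {R : realFieldType} (b c e0 : R) : 0 < e0 ->
  (forall e, 0 < e <= e0 -> 0 <= 2 * e * b + e ^+ 2 * c) -> 0 <= b.
Proof.
move=> e00 H; rewrite leNgt; apply/negP => b0.
have c1 : 0 < `|c| + 1 by rewrite ltr_wpDl.
(* With this [e] one has [e * c <= - b], hence [2 * b + e * c <= b < 0]. *)
pose e := Num.min e0 (- b / (`|c| + 1)).
have e_gt0 : 0 < e by rewrite lt_min e00 divr_gt0// oppr_gt0.
have := H e; rewrite e_gt0 ge_min lexx => /(_ isT).
rewrite (_ : _ + _ = e * (2 * b + e * c)); last by ring.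
rewrite pmulr_rge0// leNgt => /negP; apply.
have : e * c <= - b.
  rewrite (le_trans (y := e * (`|c| + 1)))//.
    by rewrite ler_pM2l// (le_trans (ler_norm _))// lerDl.
  by rewrite -ler_pdivlMr// ge_min lexx orbT.
lra.
Qed.

Section minimizers.
Context {R : realType} {n k : nat}.
Variables (x : 'rV[R]_n) (W : 'I_k -> 'rV[R]_n).

Let comb (b : 'rV[R]_k) := x + \sum_j b ord0 j *: W j.

Lemma min_enorm_comb (A : set 'rV[R]_k) : A !=set0 -> compact A ->
  exists2 c, A c & forall b, A b -> dot (comb c) (comb c) <= dot (comb b) (comb b).
Proof.
move=> A0 cA.
have [|c] := @compact_EVT_min _ _ (fun b => dot (comb b) (comb b)) A A0 cA.
  apply: continuous_subspaceT.
  have coordc (i : 'I_n) : continuous (fun b => comb b ord0 i).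
    have -> : (fun b => comb b ord0 i) =
        (fun b => x ord0 i + \sum_j b ord0 j * W j ord0 i).
      by apply/funext => b; rewrite mxE summxE; congr (_ + _); apply: eq_bigr => j _; rewrite mxE.
    apply: continuous_add; first exact: cst_continuous.
    apply: continuous_sum_ord => j; apply: continuous_mul.
      exact: coord_continuous.
    exact: cst_continuous.
  by apply: continuous_sum_ord => i; exact: continuous_mul.
rewrite inE => Ac cmin; exists c => // b Ab; apply: cmin; exact/mem_set.
Qed.

(** First-order optimality condition at [c] in the direction [d]. *)
Lemma comb_step_ge0 (c : 'rV[R]_k) (d : 'I_k -> R) :
  (forall e, 0 < e <= 1 -> dot (comb c) (comb c) <=
     dot (comb c + e *: \sum_j d j *: W j) (comb c + e *: \sum_j d j *: W j)) ->
  0 <= dot (comb c) (\sum_j d j *: W j).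
Proof.
move: (comb c) (\sum_j _) => y z H.
apply: (@linear_term_ge0 _ _ (dot z z) 1) => // e /H.
by rewrite !dotE (dotC z); lra.
Qed.

End minimizers.

Lemma compact_box {R : realType} k (M : R) :
  compact [set b : 'rV[R]_k | forall i, 0 <= b ord0 i <= M].
Proof.
rewrite [X in compact X](_ : _ =
    [set b : 'rV[R]_k | forall i, `[0, M]%classic (b ord0 i)]).
  by apply: (@rV_compact _ _ (fun=> `[0, M]%classic)) => _; exact: segment_compact.
by apply/seteqP; split => b /= bM i; have := bM i; rewrite in_itv.
Qed.

(** [y] is the point of the hull nearest to the origin; the inequality is the first-order condition
    for moving it towards [W j]. *)
Lemma conv_hull_min_norm {R : realType} n k (W : 'I_k.+1 -> 'rV[R]_n) :
  exists y, conv_hull W y /\ forall j, dot y y <= dot y (W j).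
Proof.
pose A := [set b : 'rV[R]_k.+1 | forall i, 0 <= b ord0 i <= 1] `&`
  [set b | \sum_i b ord0 i = 1].
have [||c [cA c1] cmin] := @min_enorm_comb R n k.+1 0 W A.
- exists (delta_mx ord0 ord0); split => [i|] /=.
    by rewrite mxE/=; case: eqP => _ /=; rewrite ler01 lexx.
  rewrite (bigD1 ord0)//= mxE !eqxx/= big1 ?addr0// => i /negbTE i0.
  by rewrite mxE i0 andbF.
- apply: compact_closedI; first exact: compact_box.
  apply: (@closed_comp _ _ (fun b : 'rV[R]_k.+1 => \sum_i b ord0 i) [set 1]).
    by move=> b _; apply: continuous_sum_ord => i {}b; exact: coord_continuous.
  exact: closed_eq.
exists (\sum_j c ord0 j *: W j); split.
  by exists (c ord0); split => // i; have /andP[] := cA i.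
move=> j; rewrite -subr_ge0.
set y := \sum_j _; have -> : dot y (W j) - dot y y = dot y (W j - y).
  by rewrite !dotE.
rewrite /y {y}.
have := @comb_step_ge0 R n k.+1 0 W c (fun i => (i == j)%:R - c ord0 i).
have -> : \sum_i ((i == j)%:R - c ord0 i) *: W i = W j - \sum_i c ord0 i *: W i.
  under eq_bigr do rewrite scalerBl.
  by rewrite sumrB sum_delta_scale.
rewrite !add0r; apply => e /andP[e0 e1].
pose b := (1 - e) *: c + e *: delta_mx ord0 j.
have := cmin b; rewrite !add0r.
have -> : \sum_i b ord0 i *: W i =
    \sum_i c ord0 i *: W i + e *: (W j - \sum_i c ord0 i *: W i).
  have -> : \sum_i b ord0 i *: W i =
     (1 - e) *: (\sum_i c ord0 i *: W i) + e *: \sum_i (i == j)%:R *: W i.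
    rewrite !scaler_sumr -big_split; apply: eq_bigr => i _.
    by rewrite /= !mxE eqxx/= !scalerA -scalerDl.
  rewrite sum_delta_scale scalerBr scalerBl scale1r -!addrA; congr (_ + _).
  by rewrite addrC.
apply; split => [i|] /=.
  have /andP[ci0 ci1] := cA i.
  by rewrite !mxE eqxx/=; case: eqP => _ /=; apply/andP; split; nra.
have sumb : \sum_i b ord0 i = (1 - e) * \sum_i c ord0 i + e * \sum_i (i == j)%:R.
  rewrite !mulr_sumr -big_split; apply: eq_bigr => i _; by rewrite /= !mxE eqxx.
by rewrite sumb c1 sum_delta; ring.
Qed.

(** [p] is the projection of [- x] onto the cone of [W], found by minimizing the norm of [x + p].
    The bound [dot y y <= dot y (W j)] controls the coefficients by the norm of [p], so that a
    compact box suffices. *)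
Lemma cone_projection {R : realType} n k (W : 'I_k -> 'rV[R]_n) (x y : 'rV[R]_n) :
  y != 0 -> (forall j, dot y y <= dot y (W j)) ->
  exists b : 'I_k -> R, let p := \sum_j b j *: W j in
  [/\ forall j, 0 <= b j, forall j, - dot x (W j) <= dot p (W j) &
      dot p p <= dot x x].
Proof.
rewrite -dot_gt0 => y0 yW.
(* [M] bounds the coefficients of the minimizer, by [|p| <= 2 * |x|] and
   [c j * |y|^2 <= dot y p <= |y| * |p|]. The box has side [M + 1], which leaves room to increase a
   coefficient by up to [1]. *)
pose M := 2 * (enorm x * enorm y) / dot y y.
have M0 : 0 <= M by rewrite divr_ge0 ?(ltW y0)// !mulr_ge0 ?enorm_ge0.
pose A := [set b : 'rV[R]_k | forall i, 0 <= b ord0 i <= M + 1].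
have M1 : 0 <= M + 1 by rewrite addr_ge0.
have A0 : A 0 by move=> i; rewrite mxE lexx.
have [c cA cmin] := @min_enorm_comb R n k x W A (ex_intro _ 0 A0) (@compact_box _ _ _).
have comb0 : x + \sum_j (0 : 'rV[R]_k) ord0 j *: W j = x.
  by rewrite big1 ?addr0// => i _; rewrite mxE scale0r.
have {}cmin0 := cmin 0 A0; rewrite comb0 in cmin0.
pose p := \sum_j c ord0 j *: W j.
have c0 j : 0 <= c ord0 j by have /andP[] := cA j.
have px : enorm (x + p) <= enorm x.
  by rewrite enorm_sqr_le ?enorm_ge0// enorm_sqr.
have p2x : enorm p <= 2 * enorm x.
  have := enormD (x + p) (- x); rewrite addrC addKr enormN; lra.
have cM j : c ord0 j <= M.
  rewrite ler_pdivlMr//.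
  have : dot y p <= enorm y * enorm p := dot_le_enorm _ _.
  have : c ord0 j * dot y y <= dot y p.
    rewrite dotC dot_comb (bigD1 j)//= dotC ler_wpDr//.
      apply: sumr_ge0 => i _; rewrite mulr_ge0// dotC.
      by rewrite (le_trans _ (yW i))// dot_ge0.
    by rewrite ler_wpM2l// dotC.
  have := enorm_ge0 y; have := enorm_ge0 p; nra.
exists (c ord0) => /=; rewrite -/p.
have stepA (d : 'I_k -> R) : (forall e j, 0 < e <= 1 -> 0 <= c ord0 j + e * d j <= M + 1) ->
    0 <= dot (x + p) (\sum_j d j *: W j).
  move=> dA; apply: (@comb_step_ge0 R n k x W c d) => e e01.
  have := cmin (\row_j (c ord0 j + e * d j)).
  have -> : \sum_j (\row_j (c ord0 j + e * d j)) ord0 j *: W j =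
      p + e *: \sum_j d j *: W j.
    rewrite scaler_sumr -big_split; apply: eq_bigr => j _.
    by rewrite /= mxE scalerDl scalerA.
  by rewrite addrA; apply => j; rewrite mxE; exact: dA.
split => // [j|].
  (* Increasing the coefficient of [W j] gives [0 <= dot (x + p) (W j)]. *)
  have := stepA (fun i => (i == j)%:R).
  rewrite sum_delta_scale.
  rewrite dotDl => H; rewrite lerNl -subr_ge0 opprK H// => e i /andP[e0 e1].
  by have := c0 i; have := cM i; case: eqP => _ /=; nra.
(* Shrinking all coefficients proportionally gives [dot (x + p) p <= 0]; then [0 <= |x + p|^2]
   yields the norm bound. *)
have := stepA (fun i => - c ord0 i).
under eq_bigr do rewrite scaleNr; rewrite sumrN -/p dotNr dotDl => H.
have {H} xp : dot x p + dot p p <= 0.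
  rewrite -oppr_ge0 H// => e j /andP[e0 e1]; have := c0 j; have := cM j; nra.
have : 0 <= dot (x + p) (x + p) by exact: dot_ge0.
rewrite !dotE (dotC p x); have := dot_ge0 (x - p).
rewrite !dotE (dotC p x); lra.
Qed.

(* With [x = v ord0] and [W] the other points, the new point is [- (p + tau *: y)],
   where [p] is the projection of [- x] onto the cone of [W], [y] the point of
   minimal norm of the convex hull of [W], and [tau] restores the norm. *)
Lemma spread_out {R : realType} n k (v : 'I_k.+2 -> 'rV[R]_n) :
  exists v' : 'I_k.+2 -> 'rV[R]_n,
  [/\ dot (v' ord0) (v' ord0) = dot (v ord0) (v ord0),
      forall j, v' (lift ord0 j) = v (lift ord0 j),
      forall j, dot (v' ord0) (v (lift ord0 j)) <= dot (v ord0) (v (lift ord0 j)) &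
      conv_hull v' 0].
Proof.
pose W j := v (lift ord0 j); pose x := v ord0.
have [y [[c [c0 c1 yE]] yW]] := conv_hull_min_norm W.
have [y0|y0] := eqVneq y 0.
  exists v; split => //.
  exists (fun i => if unlift ord0 i is Some j then c j else 0); split.
  - by move=> i; case: unliftP.
  - by rewrite big_ord_recl unlift_none add0r -[RHS]c1; apply: eq_bigr => i _; rewrite liftK.
  - rewrite big_ord_recl unlift_none scale0r add0r -[LHS]y0 yE.
    by apply: eq_bigr => i _; rewrite liftK.
have [b [b0 pW px]] := cone_projection x y0 yW.
set p := \sum_j _ in pW px.
have yy : 0 < dot y y by rewrite dot_gt0.
have py : 0 <= dot p y.
  rewrite dot_comb sumr_ge0// => j _; rewrite mulr_ge0// dotC.
  by rewrite (le_trans _ (yW j))// ltW.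
(* [tau] is the nonnegative root of [|p + tau *: y|^2 = |x|^2], and [D] is a quarter of the
   discriminant. *)
pose D := dot p y ^+ 2 + dot y y * (dot x x - dot p p).
have D0 : 0 <= D by rewrite addr_ge0 ?sqr_ge0// mulr_ge0 ?(ltW yy)// subr_ge0.
pose tau := (Num.sqrt D - dot p y) / dot y y.
have tau0 : 0 <= tau.
  rewrite divr_ge0 ?(ltW yy)// subr_ge0 -[leLHS]ger0_norm// -sqrtr_sqr ler_wsqrtr// lerDl.
  by rewrite mulr_ge0 ?(ltW yy)// subr_ge0.
pose t := - (p + tau *: y).
have tt : dot t t = dot x x.
  rewrite /t !dotE (dotC y p).
  have e1 : tau * dot y y = Num.sqrt D - dot p y by rewrite mulfVK ?gt_eqF.
  apply: (mulIf (x := dot y y)); first by rewrite gt_eqF.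
  have e2 := sqr_sqrtr D0; rewrite {2}/D in e2.
  transitivity (dot p p * dot y y + 2 * dot p y * (tau * dot y y) + (tau * dot y y) ^+ 2).
    by ring.
  rewrite e1; transitivity (dot p p * dot y y - dot p y ^+ 2 + Num.sqrt D ^+ 2); first by ring.
  by rewrite e2; ring.
have tW j : dot t (W j) <= dot x (W j).
  have := pW j; have : 0 <= tau * dot y (W j).
    by rewrite mulr_ge0// (le_trans _ (yW j))// ltW.
  by rewrite /t !dotE; lra.
exists (fun i => if unlift ord0 i is Some j then W j else t); split.
- by rewrite unlift_none.
- by move=> j; rewrite liftK.
- by move=> j; rewrite unlift_none; exact: tW.
(* [t] is minus the combination of the [W j] with coefficients [b j + tau * c j]; dividing by the
   total weight [S] writes [0] as a convex combination. *)
pose S := 1 + \sum_j (b j + tau * c j).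
have bc0 j : 0 <= b j + tau * c j by rewrite addr_ge0// mulr_ge0.
have S0 : 0 < S by rewrite ltr_wpDr// sumr_ge0.
exists (fun i => (if unlift ord0 i is Some j then b j + tau * c j else 1) / S); split.
- by move=> i; rewrite divr_ge0 ?(ltW S0)//; case: unliftP.
- rewrite -mulr_suml big_ord_recl unlift_none.
  under eq_bigr do rewrite liftK.
  by rewrite divff// gt_eqF.
rewrite big_ord_recl !unlift_none; under eq_bigr do rewrite !liftK mulrC -scalerA.
rewrite -scaler_sumr mul1r -scalerDr.
under eq_bigr do rewrite scalerDl -scalerA.
rewrite big_split/= -scaler_sumr -yE -/p /t addNr scaler0//.
Qed.

(** * Approximation by positively spanning families *)

Lemma unitmx_shift {R : realFieldType} n (M : 'M[R]_n) (e : R) : 0 < e ->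
  exists2 d, 0 < d <= e & M + d%:M \in unitmx.
Proof.
move=> e0; pose p := char_poly M.
have p0 : p != 0 by rewrite monic_neq0// char_poly_monic.
(* There are more distinct candidates than the degree of the characteristic polynomial, so one of
   them is not an eigenvalue; [d] is its opposite. *)
pose rs := [seq - (e / i.+1%:R) | i <- iota 0 (size p)].
have urs : uniq rs.
  rewrite map_inj_uniq ?iota_uniq// => i j /oppr_inj/(mulfI (lt0r_neq0 e0))/invr_inj/eqP.
  by rewrite eqr_nat => /eqP[].
have : ~~ all (root p) rs.
  apply/negP => /(max_poly_roots p0)/(_ urs).
  by rewrite size_map size_iota ltnn.
rewrite -has_predC => /hasP[_ /mapP[i _ ->] /= Np].
exists (e / i.+1%:R).
  rewrite divr_gt0//= ler_pdivrMr// ler_peMr ?(ltW e0)//.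
  by rewrite ler1n.
rewrite -row_free_unit -kermx_eq0 -[X in M + X]opprK -rmorphN/=.
by move: Np; rewrite -eigenvalue_root_char negbK.
Qed.

(** The conditions under which the half-spaces of [v] at a positive level bound a simplex. *)
Definition positively_spanning {R : realType} n (v : 'I_n.+1 -> 'rV[R]_n) :=
  spanning v /\ exists a : 'I_n.+1 -> R,
    [/\ forall i, 0 < a i, \sum_i a i = 1 & \sum_i a i *: v i = 0].

Lemma unitmx_spanning {R : realType} n (v : 'I_n.+1 -> 'rV[R]_n) :
  (\matrix_(j < n, k < n) v (lift ord0 j) ord0 k) \in unitmx -> spanning v.
Proof.
rewrite -unitmx_tr => uV x xv; have := mulmxK uV x.
set y := x *m _; have -> : y = 0.
  apply/rowP => j; rewrite !mxE -[RHS](xv (lift ord0 j)).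
  by apply: eq_bigr => k _; rewrite !mxE.
by rewrite mul0mx.
Qed.

Lemma positively_spanning_dense {R : realType} n (v : 'I_n.+1 -> 'rV[R]_n) (r e : R) :
  0 < r -> 0 < e -> (forall i, enorm (v i) <= r) -> conv_hull v 0 ->
  exists u, [/\ positively_spanning u, forall i, enorm (u i) <= r &
                forall i, enorm (u i - v i) <= e].
Proof.
move=> r0 e0 vr [a [a0 a1 /esym av0]].
(* The displacement [h * C] splits into [h * (n.+1%:R * r)] for the correction along [m] and [h] for
   the generic perturbation. *)
pose C := n.+1%:R * r + 1.
have C0 : 0 < C by rewrite ltr_wpDl// mulr_ge0 ?(ltW r0).
have [h h0 hC] : exists2 h, 0 < h & h * C = e / 2.
  by exists (e / 2 / C); rewrite ?divr_gt0// divfK// gt_eqF.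
have ah i : 0 < a i + h by rewrite ltr_wpDl.
pose m := \sum_i v i.
(* The unit vectors at the indices other than [ord0] add [d] to the diagonal of the matrix of the
   [q i]; [z ord0] balances them. *)
pose z i : 'rV[R]_n := if unlift ord0 i is Some j then delta_mx ord0 j else
  - \sum_j ((a (lift ord0 j) + h) / (a ord0 + h)) *: delta_mx ord0 j.
pose Z := 1 + \sum_i enorm (z i).
have Z0 : 0 < Z by rewrite ltr_wpDr// sumr_ge0// => i _; exact: enorm_ge0.
(* The weights [a i + h] are positive; the [q i] are moved so that they still
   balance, and the [z i] so that a generic multiple of them makes the family span. *)
pose q i := v i - (h * (a i / (a i + h))) *: m.
have [d /andP[d0 dh] uq] := unitmx_shift
  (\matrix_(j < n, k < n) q (lift ord0 j) ord0 k) (divr_gt0 h0 Z0).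
pose V i := q i + d *: z i.
have zsum : \sum_i (a i + h) *: z i = 0.
  rewrite big_ord_recl {1}/z unlift_none scalerN scaler_sumr addrC.
  apply/eqP; rewrite subr_eq0; apply/eqP; apply: eq_bigr => j _.
  by rewrite /z liftK scalerA mulrC divfK// gt_eqF.
have qsum : \sum_i (a i + h) *: q i = 0.
  under eq_bigr => i _.
    rewrite /q scalerBr scalerDl scalerA mulrCA (mulrC (a i + h)) divfK ?gt_eqF//.
    over.
  rewrite sumrB big_split/= av0 add0r -scaler_sumr -scaler_suml -mulr_sumr a1.
  by rewrite mulr1 subrr.
have Vsum : \sum_i (a i + h) *: V i = 0.
  under eq_bigr do rewrite scalerDr scalerA mulrC -scalerA.
  by rewrite big_split/= qsum -scaler_sumr zsum scaler0 addr0.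
have Vv i : enorm (V i - v i) <= e / 2.
  rewrite /V /q addrAC (addrAC (v i)) subrr sub0r.
  rewrite (le_trans (enormD _ _))// enormN !enormZ -hC.
  have dz : `|d| * enorm (z i) <= h.
    rewrite gtr0_norm// (le_trans (y := h / Z * Z))//; last by rewrite divfK// gt_eqF.
    apply: ler_pM => //; rewrite ?(ltW d0) ?enorm_ge0//.
    rewrite /Z (bigD1 i)//= addrCA lerDl addr_ge0// sumr_ge0// => j _.
    exact: enorm_ge0.
  have mr : enorm m <= n.+1%:R * r.
    rewrite (le_trans (enorm_sum _ _ _))//.
    rewrite (le_trans (ler_sum _ (fun i _ => vr i)))//.
    by rewrite sumr_const card_ord mulr_natl.
  have ai : 0 <= a i / (a i + h) <= 1.
    by rewrite divr_ge0 ?(ltW (ah i))//= ler_pdivrMr// mul1r lerDl ltW.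
  have : `|h * (a i / (a i + h))| * enorm m <= h * (n.+1%:R * r).
    case/andP: ai => ai0 ai1; rewrite ger0_norm; last by apply: mulr_ge0 => //; exact: ltW.
    apply: ler_pM => //; last by rewrite ger_pMr.
      by apply: mulr_ge0 => //; exact: ltW.
    exact: enorm_ge0.
  by rewrite /C mulrDr mulr1; lra.
(* The perturbed points have norm at most [r + e / 2]; the factor [k] returns them to the ball of
   radius [r], at the cost of at most another [e / 2]. *)
pose k := r / (r + e / 2).
have re : 0 < r + e / 2 by rewrite addr_gt0// divr_gt0.
have k0 : 0 < k by rewrite divr_gt0.
have k1 : k <= 1 by rewrite ler_pdivrMr// mul1r lerDl divr_ge0// ltW.
have kE : k * (r + e / 2) = r by rewrite divfK// gt_eqF.
exists (fun i => k *: V i); split; first split.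
- move=> x xV; suff : spanning V.
    apply => i; have /eqP := xV i.
    by rewrite dotZr mulf_eq0 gt_eqF//= => /eqP.
  apply: unitmx_spanning; rewrite [X in X \in _](_ : _ =
    (\matrix_(j < n, k < n) q (lift ord0 j) ord0 k) + d%:M)//.
  apply/matrixP => i j; rewrite [LHS]mxE [RHS]mxE [X in _ = X + _]mxE /V.
  by rewrite /z liftK [LHS]mxE !mxE eqxx/= (eq_sym j) mulr_natr.
- pose S := \sum_i (a i + h).
  have S0 : 0 < S.
    by rewrite /S big_ord_recl ltr_wpDr// sumr_ge0// => i _; exact: ltW.
  exists (fun i => (a i + h) / S); split => [i||].
  + exact: divr_gt0.
  + by rewrite -mulr_suml divff// gt_eqF.
  + transitivity ((k / S) *: \sum_i (a i + h) *: V i); last by rewrite Vsum scaler0.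
    rewrite scaler_sumr; apply: eq_bigr => i _; rewrite !scalerA; congr (_ *: _); ring.
- move=> i; rewrite enormZ gtr0_norm// -[leRHS]kE ler_wpM2l ?(ltW k0)//.
  by rewrite -[V i](subrK (v i)) (le_trans (enormD _ _))// addrC lerD.
- move=> i; have -> : k *: V i - v i = k *: (V i - v i) - (1 - k) *: v i.
    by rewrite scalerBr scalerBl scale1r opprB addrA subrK.
  rewrite (le_trans (enormD _ _))// enormN !enormZ gtr0_norm// ger0_norm ?subr_ge0//.
  have := Vv i; have := vr i; have := enorm_ge0 (V i - v i); nra.
Qed.

(** * Translation and isometry invariance of the Lebesgue integral *)

Section lebesgue_rV_integral.
Context {R : realType}.
Local Open Scope ereal_scope.
Let lambda := @lebesgue_measure R.

Lemma ge0_integral_lebesgue_rVS n (f : 'rV[R]_n.+1 -> \bar R) :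
  measurable_fun [set: 'rV[R]_n.+1] f -> (forall x, 0 <= f x) ->
  \int[@lebesgue_rV R n.+1]_x f x =
  \int[lambda]_a \int[@lebesgue_rV R n]_v f (cons_rV (a, v)).
Proof.
move=> mf f0.
have mc := @measurable_cons_rV R n.
have mfc : measurable_fun setT (f \o @cons_rV R n) by exact: measurableT_comp.
have f0' : {in setT, forall x, 0 <= f x} by move=> x _; exact: f0.
rewrite -(fubini_tonelli1 (m1 := lambda) (m2 := @lebesgue_rV R n) _ mfc (fun x => f0 _)).
exact: (ge0_integral_pushforward mc (lambda \x @lebesgue_rV R n) measurableT mf f0').
Qed.

(** Lebesgue measure is determined by its values on half-open intervals, whose length a translation
    preserves. *)
Lemma ge0_integral_shift (f : R -> \bar R) (c : R) :
  measurable_fun [set: R] f -> (forall x, 0 <= f x) ->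
  \int[lambda]_a f (a + c)%R = \int[lambda]_a f a.
Proof.
move=> mf f0.
have ms : measurable_fun [set: measurableTypeR R] (fun a : measurableTypeR R => a + c : measurableTypeR R)%R.
  by apply: measurable_funD => //; exact: measurable_id.
transitivity (\int[pushforward lambda (fun a : measurableTypeR R => a + c : measurableTypeR R)%R]_a f a).
  by rewrite (ge0_integral_pushforward ms).
apply/esym/eq_measure_integral => A mA _.
apply: lebesgue_measure_unique => // X /ocitvP[->|[[a b] /= ab ->]].
  by rewrite !measure0.
rewrite /pushforward (_ : _ @^-1` _ = `](a - c)%R, (b - c)%R]%classic); last first.
  by apply/seteqP; split => x /=; rewrite !in_itv/= ltrBlDr lerBrDr.
rewrite !lebesgue_measure_itv/= !lte_fin ltrD2r ab -!EFinB.
by congr EFin; ring.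
Qed.

Lemma measurable_shift_rV n (c : 'rV[R]_n) : measurable_fun [set: 'rV[R]_n] (fun x => x + c)%R.
Proof.
apply/measurable_fun_rVP => i.
apply: (eq_measurable_fun (fun x : 'rV[R]_n => x ord0 i + c ord0 i)%R).
  by move=> x _; rewrite mxE.
by apply: measurable_funD => //; exact: measurable_coord_rV.
Qed.

Lemma ge0_integral_shift_rV n (f : 'rV[R]_n -> \bar R) (c : 'rV[R]_n) :
  measurable_fun [set: 'rV[R]_n] f -> (forall x, 0 <= f x) ->
  \int[@lebesgue_rV R n]_x f (x + c)%R = \int[@lebesgue_rV R n]_x f x.
Proof.
elim: n f c => [|n ih] f c mf f0.
  by apply: eq_integral => x _; rewrite [(x + c)%R]thinmx0 [in RHS]thinmx0.
pose c' : 'rV[R]_n := \row_j c ord0 (lift ord0 j).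
have mfc : measurable_fun setT (f \o @cons_rV R n).
  exact: (measurableT_comp mf (@measurable_cons_rV R n)).
have mfs : measurable_fun [set: 'rV[R]_n.+1] (fun x => f (x + c)%R).
  exact: (measurableT_comp mf (measurable_shift_rV c)).
rewrite (ge0_integral_lebesgue_rVS mfs (fun x => f0 _)).
rewrite (ge0_integral_lebesgue_rVS mf f0).
transitivity (\int[lambda]_a \int[@lebesgue_rV R n]_v f (cons_rV ((a + c ord0 ord0)%R, v))).
  apply: eq_integral => a _.
  rewrite -(ih (fun v => f (cons_rV ((a + c ord0 ord0)%R, v))) c')//; last first.
    by apply: (measurableT_comp mfc); exact: measurable_pair1.
  apply: eq_integral => v _; congr f; apply/rowP => i; rewrite !mxE.
  by case: unliftP => [j ->|->] /=; rewrite ?mxE.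
apply: (ge0_integral_shift (f := fun a => \int[@lebesgue_rV R n]_v f (cons_rV (a, v)))).
  exact: (measurable_fun_fubini_tonelli_F (f \o @cons_rV R n) mfc (fun x => f0 _)).
by move=> a; exact: integral_ge0.
Qed.

End lebesgue_rV_integral.

Definition gauss_density {R : realType} n (x : 'rV[R]_n) : R := expR (- dot x x).

Lemma gauss_density_gt0 {R : realType} n (x : 'rV[R]_n) : 0 < gauss_density x.
Proof. exact: expR_gt0. Qed.

Section gaussian.
Context {R : realType}.
Local Open Scope ereal_scope.

Lemma measurable_dotl n (v : 'rV[R]_n) : measurable_fun [set: 'rV[R]_n] (fun x => dot x v).
Proof.
apply: measurable_sum => i.
by apply: measurable_funM => //; exact: measurable_coord_rV.
Qed.

Lemma measurable_gauss_density n : measurable_fun [set: 'rV[R]_n] (@gauss_density R n).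
Proof.
apply: measurableT_comp => //; apply: measurableT_comp => //.
by apply: measurable_sum => i; apply: measurable_funM; exact: measurable_coord_rV.
Qed.

Let measurable_G n : measurable_fun [set: 'rV[R]_n] (fun x => (gauss_density x)%:E).
Proof. by apply/measurable_EFinP; exact: measurable_gauss_density. Qed.

Let G_ge0 n (x : 'rV[R]_n) : 0 <= (gauss_density x)%:E.
Proof. by rewrite lee_fin ltW// gauss_density_gt0. Qed.

Let c_ge0 n : 0 <= (Num.sqrt (pi : R) ^+ n)%:E.
Proof. by rewrite lee_fin exprn_ge0// sqrtr_ge0. Qed.

(** The value matters through being finite and positive: it is cancelled as a factor below, and it
    allows passing to complements. *)
Lemma integral_gauss_density n :
  \int[@lebesgue_rV R n]_x (gauss_density x)%:E = (Num.sqrt pi ^+ n)%:E.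
Proof.
elim: n => [|n ih].
  rewrite [LHS](@integral_dirac _ _ (0%R : 'rV[R]_0) R _ measurableT _ (@measurable_G 0)).
  by rewrite diracT mul1e /gauss_density dot0l oppr0 expR0 expr0.
rewrite (ge0_integral_lebesgue_rVS (@measurable_G n.+1) (@G_ge0 _)).
have split_density a (v : 'rV[R]_n) :
    gauss_density (cons_rV (a, v)) = (gauss_fun a * gauss_density v)%R.
  rewrite /gauss_density /gauss_fun -expRD; congr expR.
  rewrite /dot big_ord_recl mxE unlift_none/= opprD expr2; congr (_ - _)%R.
  by apply: eq_bigr => i _; rewrite mxE liftK.
transitivity (\int[@lebesgue_measure R]_a ((gauss_fun a)%:E * (Num.sqrt pi ^+ n)%:E)).
  apply: eq_integral => a _; rewrite -ih.
  rewrite -(ge0_integralZl _ measurableT (@measurable_G n) (fun x _ => G_ge0 x)).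
    by apply: eq_integral => v _; rewrite split_density EFinM.
  by rewrite lee_fin gauss_fun_ge0.
have mgf : measurable_fun [set: measurableTypeR R] (fun a => (gauss_fun (a : R))%:E).
  by apply/measurable_EFinP; exact: measurable_gauss_fun.
rewrite (ge0_integralZr _ measurableT mgf _ (c_ge0 n)).
  by rewrite integralT_gauss -EFinM -exprS.
by move=> a _; rewrite lee_fin gauss_fun_ge0.
Qed.

Lemma measurable_fun_addl n d (T : measurableType d)
    (p q : T -> 'rV[R]_n) : measurable_fun setT p -> measurable_fun setT q ->
  measurable_fun setT (fun t => p t + q t)%R.
Proof.
move=> mp mq; apply/measurable_fun_rVP => i.
apply: (eq_measurable_fun (fun t => p t ord0 i + q t ord0 i)%R).
  by move=> x _; rewrite mxE.
by apply: measurable_funD; exact: (proj1 (measurable_fun_rVP _)).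
Qed.

Variables (n : nat) (s : 'rV[R]_n -> 'rV[R]_n).
Hypothesis ms : measurable_fun [set: 'rV[R]_n] s.
Hypothesis sB : forall x y, s (x - y)%R = (s x - s y)%R.
Hypothesis sK : involutive s.
Hypothesis s_dot : forall x, dot (s x) (s x) = dot x x.
Let L := @lebesgue_rV R n.

(* Uniqueness of translation-invariant integrals, tested against the Gaussian
   density [G]: integrate [f (s x) * G (y + s x)] in both orders. *)
Lemma ge0_integral_isometry_opp (f : 'rV[R]_n -> \bar R) :
  measurable_fun [set: 'rV[R]_n] f -> (forall x, 0 <= f x) ->
  \int[L]_x f (s x) = \int[L]_x f (- x)%R.
Proof.
move=> mf f0; pose G (x : 'rV[R]_n) : \bar R := (gauss_density x)%:E.
have mG : measurable_fun [set: 'rV[R]_n] G := @measurable_G n.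
have G0 x : 0 <= G x := G_ge0 x.
have GN x : G (s x) = G x by rewrite /G /gauss_density s_dot.
have IG : \int[L]_x G x = (Num.sqrt pi ^+ n)%:E := integral_gauss_density n.
have mfs : measurable_fun [set: 'rV[R]_n] (f \o s) by exact: measurableT_comp.
have mGs : measurable_fun [set: 'rV[R]_n] (G \o s) by exact: measurableT_comp.
have mN : measurable_fun [set: 'rV[R]_n] (fun x => - x)%R.
  apply/measurable_fun_rVP => i.
  apply: (eq_measurable_fun (fun x : 'rV[R]_n => - x ord0 i)%R).
    by move=> x _; rewrite mxE.
  by apply: measurableT_comp => //; exact: measurable_coord_rV.
have mfN : measurable_fun [set: 'rV[R]_n] (fun x => f (- x)%R) by exact: measurableT_comp.
pose H (p : 'rV[R]_n * 'rV[R]_n) := f (s p.1) * G (p.2 + s p.1)%R.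
have mH : measurable_fun setT H.
  apply: emeasurable_funM; first exact: (measurableT_comp mfs measurable_fst).
  apply: (measurableT_comp mG); apply: measurable_fun_addl => //.
  exact: (measurableT_comp ms measurable_fst).
have H0 p : 0 <= H p by rewrite mule_ge0.
have Hl : \int[L]_x \int[L]_y H (x, y) = \int[L]_x f (s x) * (Num.sqrt pi ^+ n)%:E.
  transitivity (\int[L]_x (f (s x) * (Num.sqrt pi ^+ n)%:E)).
    apply: eq_integral => x _; rewrite /H/=.
    have mGx := measurableT_comp mG (measurable_shift_rV (s x)).
    rewrite (ge0_integralZl _ measurableT mGx (fun y _ => G0 _) (f0 _))/=.
    by rewrite (ge0_integral_shift_rV (s x) mG)// IG.
  exact: (ge0_integralZr L measurableT mfs (fun y _ => f0 _) (c_ge0 n)).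
have Hr : \int[L]_y \int[L]_x H (x, y) = (Num.sqrt pi ^+ n)%:E * \int[L]_x f (- x)%R.
  pose K (p : 'rV[R]_n * 'rV[R]_n) := f (s p.1 - p.2)%R * G (s p.1).
  have mK : measurable_fun setT K.
    apply: emeasurable_funM; last exact: (measurableT_comp mGs measurable_fst).
    apply: (measurableT_comp mf); apply: measurable_fun_addl.
      exact: (measurableT_comp ms measurable_fst).
    exact: (measurableT_comp mN measurable_snd).
  have K0 p : 0 <= K p by rewrite mule_ge0.
  transitivity (\int[L]_y \int[L]_x K (x, y)).
    apply: eq_integral => y _.
    have mHy : measurable_fun [set: 'rV[R]_n] (fun x => H (x, y)).
      by apply: (measurableT_comp mH); exact: measurable_pair2.
    (* Translating [x] by [- s y] turns [s x] into [s x - y], because [s] is an additive involution;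
       the Gaussian factor becomes [G (s x)], free of [y]. *)
    transitivity (\int[L]_x (fun x => H (x, y)) (x + - s y)%R).
      exact: (esym (ge0_integral_shift_rV (- s y)%R mHy (fun x => H0 _))).
    apply: eq_integral => x _; rewrite /H /K/= sB sK.
    by congr (_ * G _); rewrite addrC subrK.
  rewrite -(fubini_tonelli (m1 := L) (m2 := L) _ mK K0).
  transitivity (\int[L]_x (G x * \int[L]_x f (- x)%R)).
    apply: eq_integral => x _; rewrite /K/=.
    have mfx : measurable_fun [set: 'rV[R]_n] (fun y => f (s x - y)%R).
      by apply: (measurableT_comp mf); exact: measurable_fun_addl.
    rewrite (ge0_integralZr _ measurableT mfx (fun y _ => f0 _) (G0 _)).
    rewrite GN muleC; congr (_ * _).
    have := ge0_integral_shift_rV (- s x)%R mfN (fun x => f0 _).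
    by move=> <-; apply: eq_integral => y _; rewrite opprD opprK addrC.
  rewrite (ge0_integralZr _ measurableT mG (fun y _ => G0 _)) ?IG//.
  by apply: integral_ge0 => y _; exact: f0.
have := etrans (esym Hl) (etrans (fubini_tonelli (m1 := L) (m2 := L) _ mH H0) Hr).
have : (0 < Num.sqrt (pi : R) ^+ n)%R by rewrite exprn_gt0// sqrtr_gt0 pi_gt0.
move: (Num.sqrt pi ^+ n)%R (\int[L]_x _) (\int[L]_x _) => c a b c0 /eqP.
by rewrite muleC eq_le !lee_pmul2l// -eq_le => /eqP.
Qed.

End gaussian.

(** The preceding lemma applies to [s] and to the identity, so both integrals equal that of
    [f (- x)]. *)
Lemma ge0_integral_isometry {R : realType} n (s : 'rV[R]_n -> 'rV[R]_n)
    (f : 'rV[R]_n -> \bar R) :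
  measurable_fun [set: 'rV[R]_n] s -> (forall x y, s (x - y) = s x - s y) ->
  involutive s -> (forall x, dot (s x) (s x) = dot x x) ->
  measurable_fun [set: 'rV[R]_n] f -> (forall x, 0 <= f x)%E ->
  (\int[@lebesgue_rV R n]_x f (s x) = \int[@lebesgue_rV R n]_x f x)%E.
Proof.
move=> ms sB sK sd mf f0; rewrite ge0_integral_isometry_opp//.
by rewrite -(@ge0_integral_isometry_opp R n id)//; exact: measurable_id.
Qed.

(** * Polarization *)

Section gaussian_max.
Context {R : realType}.

(** For a nonempty family this is [expR (2 * max_i <x, v i>)]: the base value [0] lies below every
    exponential. *)
Definition exp_max n k (v : 'I_k -> 'rV[R]_n) (x : 'rV[R]_n) : R :=
  \big[Num.max/0]_(i < k) expR (2 * dot x (v i)).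

Definition exp_max_integral n k (v : 'I_k -> 'rV[R]_n) : \bar R :=
  (\int[@lebesgue_rV R n]_x (gauss_density x * exp_max v x)%:E)%E.

Lemma mulr_bigmax k (c : R) (f : 'I_k -> R) : 0 <= c ->
  \big[Num.max/0]_(i < k) (c * f i) = c * \big[Num.max/0]_(i < k) f i.
Proof.
move=> c0; elim/big_rec2 : _ => [|i a b _ ->]; first by rewrite mulr0.
by rewrite maxr_pMr.
Qed.

Lemma bigmax_le2 k (f g : 'I_k -> R) : (forall i, f i <= g i) ->
  \big[Num.max/0]_(i < k) f i <= \big[Num.max/0]_(i < k) g i.
Proof.
move=> fg; elim/big_rec2 : _ => [//|i a b _ ba].
by rewrite ge_max !le_max fg ba orbT.
Qed.

Lemma exp_max_ge0 n k (v : 'I_k -> 'rV[R]_n) x : 0 <= exp_max v x.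
Proof.
rewrite /exp_max; elim/big_rec : _ => [//|i a _ a0].
by rewrite le_max a0 orbT.
Qed.

Lemma exp_max_leP n k (v : 'I_k -> 'rV[R]_n) x (s : R) :
  (exp_max v x <= expR (2 * s)) <-> (forall i, dot x (v i) <= s).
Proof.
have two i : (expR (2 * dot x (v i)) <= expR (2 * s)) = (dot x (v i) <= s).
  by rewrite ler_expR ler_pM2l.
split => [H i|H].
  by rewrite -two (le_trans _ H)// (le_bigmax _ (fun i => expR (2 * dot x (v i)))).
rewrite /exp_max; elim/big_rec : _ => [|i a _ a0]; first exact: expR_ge0.
by rewrite ge_max a0 two H.
Qed.

Lemma measurable_exp_max n k (v : 'I_k -> 'rV[R]_n) :
  measurable_fun [set: 'rV[R]_n] (exp_max v).
Proof.
rewrite /exp_max; elim: k v => [|k ih] v.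
  apply: (eq_measurable_fun (cst (0%R : R))); last exact: measurable_cst.
  by move=> x _; rewrite big_ord0.
apply: (eq_measurable_fun ((fun x => expR (2 * dot x (v ord0))) \max
    (fun x => \big[Num.max/0]_(i < k) expR (2 * dot x (v (lift ord0 i))))))%R.
  by move=> x _; rewrite big_ord_recl.
apply: measurable_maxr; last exact: ih.
apply: measurableT_comp => //; apply: measurable_funM => //.
exact: measurable_dotl.
Qed.

Lemma measurable_exp_max_integrand n k (v : 'I_k -> 'rV[R]_n) :
  measurable_fun [set: 'rV[R]_n] (fun x => (gauss_density x * exp_max v x)%:E).
Proof.
apply/measurable_EFinP; apply: measurable_funM.
  exact: measurable_gauss_density.
exact: measurable_exp_max.
Qed.

Lemma exp_max_integrand_ge0 n k (v : 'I_k -> 'rV[R]_n) x :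
  (0 <= (gauss_density x * exp_max v x)%:E)%E.
Proof. by rewrite lee_fin mulr_ge0 ?exp_max_ge0// ltW// gauss_density_gt0. Qed.

Lemma max_gaussE n k (v : 'I_k -> 'rV[R]_n) r : (forall i, enorm (v i) = r) ->
  max_gauss v = ((expR (- r ^+ 2))%:E * exp_max_integral v)%E.
Proof.
move=> vr; rewrite /max_gauss /exp_max_integral.
have r0 : 0 <= expR (- r ^+ 2) by exact: expR_ge0.
rewrite -(ge0_integralZl _ measurableT (measurable_exp_max_integrand v)
  (fun x _ => exp_max_integrand_ge0 v x) (_ : (0 <= (expR (- r ^+ 2))%:E)%E)) ?lee_fin//.
apply: eq_integral => x _; rewrite -EFinM mulrA; congr EFin.
rewrite -mulr_bigmax; last by rewrite mulr_ge0// ltW// gauss_density_gt0.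
apply: eq_bigr => i _; rewrite /gauss_density -!expRD; congr expR.
by rewrite enorm_sqr !dotE (dotC (v i)) -[dot (v i) (v i)]enorm_sqr vr; ring.
Qed.


End gaussian_max.

Section polarization.
Context {R : realType} {n : nat}.
Variable u : 'rV[R]_n.
Hypothesis u_neq0 : u != 0.

Definition reflection (x : 'rV[R]_n) := x - (2 * dot x u / dot u u) *: u.

Let uu0 : dot u u != 0. Proof. by rewrite dot_eq0. Qed.

Lemma reflection_dot x y : dot (reflection x) y = dot x (reflection y).
Proof. by rewrite /reflection !dotE (dotC u y); ring. Qed.

Lemma reflectionB x y : reflection (x - y) = reflection x - reflection y.
Proof.
rewrite /reflection !dotE mulrBr mulrBl scalerBl !opprB addrACA [RHS]addrACA.
by rewrite (addrC (- y)).
Qed.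

Lemma reflectionK : involutive reflection.
Proof.
move=> x; rewrite /reflection !dotE -addrA -opprD -scalerDl.
rewrite [X in X *: u](_ : _ = 0) ?scale0r ?subr0//.
by field.
Qed.

Lemma measurable_reflection : measurable_fun [set: 'rV[R]_n] reflection.
Proof.
apply/measurable_fun_rVP => i.
apply: (eq_measurable_fun (fun x : 'rV[R]_n => x ord0 i - 2 * dot x u / dot u u * u ord0 i)).
  by move=> x _; rewrite !mxE.
apply: measurable_funB; first exact: measurable_coord_rV.
apply: measurable_funM => //; apply: measurable_funM => //.
by apply: measurable_funM => //; exact: measurable_dotl.
Qed.

Lemma gauss_density_reflection x : gauss_density (reflection x) = gauss_density x.
Proof. by rewrite /gauss_density reflection_dot reflectionK. Qed.

End polarization.

(** The two-point inequality of polarization: when the [a] and the [b] are ordered the same way,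
    exchanging partners joins larger values with smaller ones, which can only raise the sum of the
    maxima. *)
Lemma max_submodular {R : realDomainType} (a a' b b' : R) :
  (a' <= a /\ b' <= b) \/ (a <= a' /\ b <= b') ->
  Num.max a b + Num.max a' b' <= Num.max a' b + Num.max a b'.
Proof.
case => -[ha hb]; rewrite !maxEle; do ?case: ifP; lra.
Qed.

(** The reflection [s] that exchanges [v ord0] and [v' ord0] preserves the Gaussian measure, so it
    suffices to compare the sums of the integrands over each pair [x], [s x]. *)
Lemma exp_max_integral_polarize {R : realType} n k (v v' : 'I_k.+1 -> 'rV[R]_n) :
  dot (v' ord0) (v' ord0) = dot (v ord0) (v ord0) ->
  (forall j, v' (lift ord0 j) = v (lift ord0 j)) ->
  (forall j, dot (v' ord0) (v (lift ord0 j)) <= dot (v ord0) (v (lift ord0 j))) ->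
  (exp_max_integral v <= exp_max_integral v')%E.
Proof.
move=> v00 vj vle.
have [v0|] := eqVneq (v ord0) (v' ord0).
  suff -> : v = v' by [].
  by apply/funext => i; case: (unliftP ord0 i) => [j|] ->.
have [u uE] : exists u, u = v ord0 - v' ord0 by eexists.
rewrite -subr_eq0 -uE => u0.
pose s := reflection u.
(* Equality of the norms gives this identity, by which the reflection along [u] carries [v ord0] to
   [v' ord0]. *)
have uu : dot u u = 2 * dot (v ord0) u.
  by rewrite uE !dotE (dotC (v' ord0) (v ord0)) v00; ring.
have sv : s (v ord0) = v' ord0.
  by rewrite /s /reflection -uu divff ?dot_eq0// scale1r uE subKr.
have sv' : s (v' ord0) = v ord0 by rewrite -sv /s (reflectionK u0).
pose B x := \big[Num.max/0]_(i < k) expR (2 * dot x (v (lift ord0 i))).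
have Ev x : exp_max v x = Num.max (expR (2 * dot x (v ord0))) (B x).
  by rewrite /exp_max big_ord_recl.
have Ev' x : exp_max v' x = Num.max (expR (2 * dot x (v' ord0))) (B x).
  rewrite /exp_max big_ord_recl; congr Num.max.
  by apply: eq_bigr => i _; rewrite vj.
have B_mono x y : (forall j, dot x (v (lift ord0 j)) <= dot y (v (lift ord0 j))) ->
    B x <= B y.
  by move=> xy; apply: bigmax_le2 => j; rewrite ler_expR ler_pM2l.
have uv j : 0 <= dot u (v (lift ord0 j)) by rewrite uE !dotE subr_ge0.
have uu_gt0 : 0 < dot u u by rewrite dot_gt0.
have xu x : dot x (v' ord0) = dot x (v ord0) - dot x u by rewrite uE !dotE; ring.
have pt x : exp_max v x + exp_max v (s x) <= exp_max v' x + exp_max v' (s x).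
  rewrite !Ev !Ev' /s !reflection_dot -/s sv sv'; apply: max_submodular.
  (* Where [0 <= dot x u], the exponential for [v ord0] and [B] are both at least as large at [x] as
     at [s x], the latter by [uv]; on the other side both orders reverse. *)
  have [xu0|xu0] := leP 0 (dot x u); [left|right]; split.
  - by rewrite ler_expR ler_pM2l// xu; lra.
  - apply: B_mono => j; rewrite /s /reflection !dotE gerBl.
    by rewrite mulr_ge0// divr_ge0 ?dot_ge0// mulr_ge0.
  - by rewrite ler_expR ler_pM2l// xu; lra.
  - apply: B_mono => j; rewrite /s /reflection !dotE lerBrDl gerDr.
    by rewrite mulr_le0_ge0// pmulr_lle0 ?invr_gt0// pmulr_rle0// ltW.
pose I (w : 'I_k.+1 -> 'rV[R]_n) (x : 'rV[R]_n) := (gauss_density x * exp_max w x)%:E.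
have mI w : measurable_fun [set: 'rV[R]_n] (I w) := measurable_exp_max_integrand w.
have ms : measurable_fun [set: 'rV[R]_n] s by exact: measurable_reflection.
have mIs w : measurable_fun [set: 'rV[R]_n] (I w \o s) by exact: measurableT_comp.
have I0 w x : (0 <= I w x)%E := exp_max_integrand_ge0 w x.
have dbl w : (exp_max_integral w + exp_max_integral w =
    \int[@lebesgue_rV R n]_x (I w x + I w (s x)))%E.
  rewrite (ge0_integralD _ measurableT (fun x _ => I0 w x) (mI w)
    (fun x _ => I0 w (s x)) (mIs w)).
  congr (_ + _)%E; apply/esym.
  apply: (@ge0_integral_isometry _ _ s (I w)) => //.
  - exact: reflectionB.
  - exact: reflectionK.
  - by move=> x; rewrite /s reflection_dot reflectionK.
(* A strict inequality in the wrong direction would survive doubling, so it suffices to bound the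
   doubled integrals. *)
rewrite leNgt; apply/negP => lt; have := lteD lt lt.
rewrite ltNge => /negP; apply; rewrite !dbl.
apply: ge0_le_integral => //.
- by move=> x _; rewrite adde_ge0.
- exact: (emeasurable_funD (mI v) (mIs v)).
- exact: (emeasurable_funD (mI v') (mIs v')).
move=> x _; rewrite /I -!EFinD lee_fin /s gauss_density_reflection// -!mulrDr.
by rewrite ler_pM2l ?gauss_density_gt0// pt.
Qed.

(** * Approximation and layer cake formula *)

Section approximation.
Context {R : realType} {n k : nat}.

Lemma exp_max_perturb (u v : 'I_k -> 'rV[R]_n) (e : R) x :
  (forall i, enorm (u i - v i) <= e) ->
  exp_max v x * expR (- (2 * enorm x * e)) <= exp_max u x.
Proof.
move=> uv; rewrite mulrC -mulr_bigmax ?expR_ge0//; apply: bigmax_le2 => i.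
rewrite -expRD ler_expR.
have := dot_le_enorm x (v i - u i).
rewrite -[enorm (v i - u i)]enormN opprB dotDr dotNr.
have := ler_wpM2l (enorm_ge0 x) (uv i); lra.
Qed.

(* The damping factors [expR (- 2 |x| / m.+1)] absorb the perturbation and increase
   to [1], so that monotone convergence applies. *)
Lemma exp_max_integral_le_approx (v : 'I_k -> 'rV[R]_n) (q : \bar R) :
  (forall e, 0 < e -> exists u : 'I_k -> 'rV[R]_n,
     (forall i, enorm (u i - v i) <= e) /\ (exp_max_integral u <= q)%E) ->
  (exp_max_integral v <= q)%E.
Proof.
move=> H; pose f x := gauss_density x * exp_max v x.
pose g (m : nat) (x : 'rV[R]_n) := (f x * expR (- (2 * enorm x * m.+1%:R^-1)))%:E.
have f0 x : 0 <= f x by rewrite -lee_fin exp_max_integrand_ge0.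
have mg m : measurable_fun [set: 'rV[R]_n] (g m).
  apply/measurable_EFinP; apply: measurable_funM.
    by apply/measurable_EFinP; exact: measurable_exp_max_integrand.
  apply: measurableT_comp => //; apply: measurableT_comp => //.
  apply: measurable_funM => //; apply: measurable_funM => //.
  apply: (measurableT_comp (f := @Num.sqrt R)).
    by apply: continuous_measurable_fun; exact: sqrt_continuous.
  by apply: measurable_sum => i; apply: measurable_funX; exact: measurable_coord_rV.
have g0 m x : (0 <= g m x)%E by rewrite lee_fin mulr_ge0 ?expR_ge0.
have g_nd x : {homo g^~ x : m m' / (m <= m')%N >-> (m <= m')%E}.
  move=> m m' mm'; rewrite lee_fin ler_wpM2l// ler_expR lerN2.
  rewrite ler_wpM2l ?mulr_ge0 ?enorm_ge0//.
  by rewrite lef_pV2 ?posrE// ler_nat.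
have gf x : limn (g^~ x) = (f x)%:E.
  apply/cvg_lim => //; apply: cvg_EFin; first exact: nearW.
  rewrite [X in _ --> X](_ : _ = f x * expR 0); last by rewrite expR0 mulr1.
  apply: cvgM; first exact: cvg_cst.
  apply: continuous_cvg; first exact: continuous_expR.
  rewrite -oppr0; apply: cvgN; rewrite -[X in _ --> X](mulr0 (2 * enorm x)).
  by apply: cvgM; [exact: cvg_cst|exact: cvg_harmonic].
rewrite /exp_max_integral.
have -> : (\int[@lebesgue_rV R n]_x (gauss_density x * exp_max v x)%:E =
    \int[@lebesgue_rV R n]_x limn (g^~ x))%E.
  by apply: eq_integral => x _; rewrite gf.
rewrite (monotone_convergence _ measurableT mg (fun m x _ => g0 m x) (fun x _ => g_nd x)).
apply: lime_le.
  exact/cvgP/(cvg_monotone_convergence measurableT mg (fun m x _ => g0 m x)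
    (fun x _ => g_nd x)).
apply: nearW => m.
have [u [uv]] := H m.+1%:R^-1 ltac:(by rewrite invr_gt0); apply: le_trans.
apply: ge0_le_integral => //.
  exact: measurable_exp_max_integrand.
move=> x _; rewrite lee_fin /f -mulrA ler_wpM2l ?(ltW (gauss_density_gt0 x))//.
exact: exp_max_perturb.
Qed.

End approximation.

Section layer_cake.
Context {R : realType} {n : nat}.
Local Open Scope ereal_scope.
Let L := @lebesgue_rV R n.
Let G (x : 'rV[R]_n) : \bar R := (gauss_density x)%:E.

Let mG : measurable_fun [set: 'rV[R]_n] G.
Proof. by apply/measurable_EFinP; exact: measurable_gauss_density. Qed.

Let G0 x : 0 <= G x.
Proof. by rewrite lee_fin ltW// gauss_density_gt0. Qed.

Lemma gaussE (A : set 'rV[R]_n) : gauss A = \int[L]_(x in A) G x.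
Proof. by apply: eq_integral => x _; rewrite /G enorm_sqr. Qed.

(** The Gaussian weight on the region between [0] and the graph of [F]. Integrating out the height
    restores the factor [F x]; the slices at fixed height [t >= 0] are superlevel sets. *)
Let h (F : 'rV[R]_n -> R) (p : 'rV[R]_n * measurableTypeR R) : \bar R :=
  G p.1 * (\1_(`[0%R, F p.1[ : set R) (p.2 : R))%:E.

Let h0 F p : 0 <= h F p.
Proof. by rewrite mule_ge0// lee_fin. Qed.

Let mh F : measurable_fun [set: 'rV[R]_n] F -> measurable_fun setT (h F).
Proof.
move=> mF.
apply: emeasurable_funM; first exact: (measurableT_comp mG measurable_fst).
apply/measurable_EFinP.
have -> : (fun p : 'rV[R]_n * measurableTypeR R => \1_(`[0%R, F p.1[ : set R) (p.2 : R) : R) =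
    \1_([set p | (0 <= p.2)%R] `&` [set p | (p.2 < F p.1)%R]).
  apply/funext => p; rewrite !indicE; congr (nat_of_bool _)%:R%R; apply/idP/idP.
    by rewrite !inE/= in_itv/= => /andP[].
  by rewrite !inE/= in_itv/= => -[-> ->].
apply: measurable_indic; apply: measurableI.
  rewrite -[X in measurable X]setTI.
  have mp : measurable_fun setT (fun p : 'rV[R]_n * measurableTypeR R => 0 <= p.2)%R.
    by apply: measurable_fun_ler => //; exact: measurable_snd.
  exact: (mp measurableT [set true]).
rewrite -[X in measurable X]setTI.
have mp : measurable_fun setT (fun p : 'rV[R]_n * measurableTypeR R => p.2 < F p.1)%R.
  apply: measurable_fun_ltr; first exact: measurable_snd.
  exact: (measurableT_comp mF measurable_fst).
exact: (mp measurableT [set true]).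
Qed.

Lemma layer_cake (F : 'rV[R]_n -> R) : measurable_fun [set: 'rV[R]_n] F ->
  (forall x, 0 <= F x)%R ->
  \int[L]_x (gauss_density x * F x)%:E = \int[@lebesgue_measure R]_t \int[L]_x h F (x, t).
Proof.
move=> mF F0.
transitivity (\int[L]_x \int[@lebesgue_measure R]_t h F (x, t)).
  apply: eq_integral => x _; rewrite EFinM /h/=.
  have mi : measurable_fun [set: measurableTypeR R] (fun t => (\1_(`[0%R, F x[ : set R) (t : R))%:E : \bar R).
    by apply/measurable_EFinP; exact: measurable_indic.
  rewrite (ge0_integralZl _ measurableT mi _ (G0 x)); last by move=> t _; rewrite lee_fin.
  congr (_ * _); rewrite integral_indic//= setIT lebesgue_measure_itv/= lte_fin.
  have := F0 x; rewrite le_eqVlt => /predU1P[<-|Fx]; first by rewrite ltxx.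
  by rewrite Fx oppr0 adde0.
exact: (fubini_tonelli (m1 := L) (m2 := @lebesgue_measure R) _ (mh mF) (h0 F)).
Qed.

Let h_section F (t : R) : \int[L]_x h F (x, t) =
  if (0 <= t)%R then gauss [set x | (t < F x)%R] else 0.
Proof.
case: ifPn => t0.
  rewrite gaussE [RHS]integral_mkcond.
  apply: eq_integral => x _; rewrite patchE /h/= indicE.
  have -> : (t \in `[0%R, F x[%classic) = (x \in [set x | (t < F x)%R]).
    by apply/idP/idP; rewrite !inE/= in_itv/= t0.
  by case: ifP => _; rewrite ?mule1 ?mule0.
apply: integral0_eq => x _; rewrite /h/= indicE memNset ?mule0//.
by rewrite /= in_itv/= (negbTE t0).
Qed.

Lemma le_integral_superlevels (F F' : 'rV[R]_n -> R) :
  measurable_fun [set: 'rV[R]_n] F -> measurable_fun [set: 'rV[R]_n] F' ->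
  (forall x, 0 <= F x)%R -> (forall x, 0 <= F' x)%R ->
  (forall t, (0 <= t)%R ->
    gauss [set x | (t < F x)%R] <= gauss [set x | (t < F' x)%R]) ->
  \int[L]_x (gauss_density x * F x)%:E <= \int[L]_x (gauss_density x * F' x)%:E.
Proof.
move=> mF mF' F0 F0' FF'; rewrite (layer_cake mF F0) (layer_cake mF' F0').
apply: ge0_le_integral => //.
- by move=> t _; apply: integral_ge0 => x _; exact: h0.
- exact: (measurable_fun_fubini_tonelli_G _ (mh mF) (h0 F)).
- exact: (measurable_fun_fubini_tonelli_G _ (mh mF') (h0 F')).
- by move=> t _; rewrite !h_section; case: ifPn => // /FF'.
Qed.

(** Superlevel sets are complements of sublevel sets, and the total Gaussian mass is finite. *)
Lemma gauss_superlevel_le (F F' : 'rV[R]_n -> R) t :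
  measurable_fun [set: 'rV[R]_n] F -> measurable_fun [set: 'rV[R]_n] F' ->
  gauss [set x | (F' x <= t)%R] <= gauss [set x | (F x <= t)%R] ->
  gauss [set x | (t < F x)%R] <= gauss [set x | (t < F' x)%R].
Proof.
move=> mF mF'; rewrite !gaussE.
pose a (H : 'rV[R]_n -> R) := \int[L]_(x in [set x | (H x <= t)%R]) G x.
pose b (H : 'rV[R]_n -> R) := \int[L]_(x in [set x | (t < H x)%R]) G x.
have ab H : measurable_fun [set: 'rV[R]_n] H -> a H + b H = (Num.sqrt pi ^+ n)%:E.
  move=> mH.
  have mle : measurable [set x : 'rV[R]_n | (H x <= t)%R].
    rewrite -[X in measurable X]setTI.
    have mp : measurable_fun [set: 'rV[R]_n] (fun x => H x <= t)%R.
      exact: measurable_fun_ler.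
    exact: (mp measurableT [set true]).
  have lt_compl : [set x : 'rV[R]_n | (t < H x)%R] = ~` [set x | (H x <= t)%R].
    by apply/seteqP; split => x /=; rewrite ltNge => /negP.
  rewrite /a /b lt_compl -(ge0_integral_setU L mle (measurableC mle)).
  - by rewrite setUv; exact: integral_gauss_density.
  - by rewrite setUv.
  - by move=> x _; exact: G0.
  - by rewrite disj_set2E setICr.
have a0 H : 0 <= a H by apply: integral_ge0 => x _; exact: G0.
have b0 H : 0 <= b H by apply: integral_ge0 => x _; exact: G0.
rewrite -/(a F) -/(a F') -/(b F) -/(b F').
have := ab F mF; have := ab F' mF'.
move: (a F) (a F') (b F) (b F') (a0 F) (a0 F') (b0 F) (b0 F').
move=> [x| |] [x'| |] [y| |] [y'| |]//= _ _ _ _.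
by rewrite !lee_fin -!EFinD => -[<-] []; lra.
Qed.

End layer_cake.

(** * Comparison with the regular simplex *)

Lemma halfspaces_exp_max {R : realType} n k (v : 'I_k -> 'rV[R]_n) (s : R) :
  halfspaces v s = [set x | exp_max v x <= expR (2 * s)].
Proof. by apply/seteqP; split => x /= /exp_max_leP. Qed.

Lemma measurable_halfspaces {R : realType} n k (v : 'I_k -> 'rV[R]_n) (s : R) :
  measurable (halfspaces v s).
Proof.
rewrite halfspaces_exp_max -[X in measurable X]setTI.
have mp : measurable_fun [set: 'rV[R]_n] (fun x => exp_max v x <= expR (2 * s)).
  by apply: measurable_fun_ler => //; exact: measurable_exp_max.
exact: (mp measurableT [set true]).
Qed.

Section comparison.
Context {R : realType} {n : nat}.
Variables (w : 'I_n.+1 -> 'rV[R]_n) (r : R).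
Hypotheses (n_gt0 : (0 < n)%N) (r_gt0 : 0 < r).
Hypothesis regular_optimal : forall s : R, 0 < s ->
  forall S : set 'rV[R]_n, is_simplex S -> eball s `<=` S ->
  forall w0 : 'I_n.+1 -> 'rV[R]_n,
    regular_simplex w0 -> inscribed_ball s w0 ->
    (gauss (conv_hull w0) <= gauss S)%E.
Hypothesis w_regular : regular_simplex w.
Hypothesis w_norm : forall i, enorm (w i) = r.

Let w_sum0 : \sum_i w i = 0 := regular_simplex_sum0 n_gt0 w_regular w_norm.

Let w_spanning : spanning w := regular_simplex_spanning w_regular.

(** The products [dot x (w i)] are nonpositive and sum to zero, so they vanish and [x = 0]. The
    origin lies in the left-hand set only if [0 <= s], and then also in the other one. *)
Lemma halfspaces_le0_subset (v : 'I_n.+1 -> 'rV[R]_n) (s : R) : s <= 0 ->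
  halfspaces w s `<=` halfspaces v s.
Proof.
move=> s0 x xs.
have xw i : 0 <= - dot x (w i) by rewrite oppr_ge0 (le_trans (xs i)).
have xw0 : \sum_i - dot x (w i) = 0 by rewrite sumrN -dot_sumr w_sum0 dot0r oppr0.
have x0 : x = 0.
  apply: w_spanning => i; apply/eqP; rewrite -oppr_eq0; apply/eqP.
  exact: (psumr_eq0P (fun i _ => xw i) xw0).
by move=> i; have := xs ord0; rewrite x0 !dot0l.
Qed.

Lemma gauss_halfspaces_le (v : 'I_n.+1 -> 'rV[R]_n) (s : R) :
  positively_spanning v -> (forall i, enorm (v i) <= r) ->
  (gauss (halfspaces w s) <= gauss (halfspaces v s))%E.
Proof.
move=> [vspan [a [a0 a1 av]]] vr; have [s0|s0] := leP s 0.
  rewrite !gaussE; apply: ge0_subset_integral.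
  - exact: measurable_halfspaces.
  - exact: measurable_halfspaces.
  - apply: measurable_funTS; apply/measurable_EFinP.
    exact: measurable_gauss_density.
  - by move=> x _; rewrite lee_fin ltW// gauss_density_gt0.
  - exact: halfspaces_le0_subset.
(* At a positive level both sets are simplices containing the ball of radius [s / r], which is the
   inscribed ball of the one given by [w]; the hypothesis compares them. *)
have [p pv] := polar_vertices_exist a0 a1 av vspan s.
have pw := regular_polar_vertices n_gt0 r_gt0 w_regular w_norm s.
rewrite [X in (gauss X <= _)%E](halfspaces_conv_hull _ _ _ w_spanning s0 pw).
- apply: (regular_optimal (divr_gt0 s0 r_gt0)).
  + exists p; split; first exact: (polar_vertices_affinely_independent a0 s0 pv).
    exact: (halfspaces_conv_hull a0 a1 av vspan s0 pv).
  + exact: (eball_halfspaces r_gt0 (ltW s0) vr).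
  + exact: regular_polar_regular.
  + exact: regular_polar_inscribed.
- by move=> i; rewrite invr_gt0.
- by rewrite sumr_const card_ord -[LHS]mulr_natr mulVf.
- by rewrite -scaler_sumr w_sum0 scaler0.
Qed.

Lemma exp_max_integral_le_spanning (v : 'I_n.+1 -> 'rV[R]_n) :
  positively_spanning v -> (forall i, enorm (v i) <= r) ->
  (exp_max_integral v <= exp_max_integral w)%E.
Proof.
move=> pv vr; apply: le_integral_superlevels.
- exact: measurable_exp_max.
- exact: measurable_exp_max.
- exact: exp_max_ge0.
- exact: exp_max_ge0.
move=> t t0; apply: gauss_superlevel_le; [exact: measurable_exp_max..|].
(* A positive level is of the form [expR (2 * s)], where [s] may have any sign. *)
have [t_gt0|t_le0] := ltP 0 t.
  have -> : t = expR (2 * (ln t / 2)) by rewrite mulrC divfK// lnK.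
  rewrite -!halfspaces_exp_max; exact: gauss_halfspaces_le.
(* At level [0] the sublevel set for [w] is empty, since [exp_max w] is positive. *)
rewrite [X in gauss X](_ : _ = set0).
  by rewrite gaussE integral_set0 gaussE integral_ge0// => x _; rewrite lee_fin ltW// gauss_density_gt0.
apply/seteqP; split => x //=; rewrite leNgt => /negP; apply.
rewrite (le_lt_trans t_le0)// (lt_le_trans (expR_gt0 (2 * dot x (w ord0))))//.
exact: (le_bigmax _ (fun i => expR (2 * dot x (w i)))).
Qed.

Lemma exp_max_integral_le_conv_hull (v : 'I_n.+1 -> 'rV[R]_n) :
  conv_hull v 0 -> (forall i, enorm (v i) <= r) ->
  (exp_max_integral v <= exp_max_integral w)%E.
Proof.
move=> v0 vr; apply: exp_max_integral_le_approx => e e0.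
have [u [pu ur uv]] := positively_spanning_dense r_gt0 e0 vr v0.
by exists u; split => //; exact: exp_max_integral_le_spanning.
Qed.

End comparison.

(** * Reduction to configurations with the origin in their convex hull *)

Unset Implicit Arguments.

Theorem mainTheorem3 (R : realType) (n : nat) (hn : (1 <= n)%N)
  (hS : forall r : R, 0 < r ->
     forall S : set 'rV[R]_n, is_simplex S -> eball r `<=` S ->
     forall w0 : 'I_n.+1 -> 'rV[R]_n,
       regular_simplex w0 -> inscribed_ball r w0 ->
       (gauss (conv_hull w0) <= gauss S)%E) :
  forall r : R, 0 < r ->
  forall w : 'I_n.+1 -> 'rV[R]_n,
    regular_simplex w -> (forall i, enorm (w i) = r) ->
  forall v : 'I_n.+1 -> 'rV[R]_n,
    (forall i, enorm (v i) = r) -> (max_gauss v <= max_gauss w)%E.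
Proof.
case: n hn hS => [|n] hn hS; first discriminate hn.
move=> r r0 w w_regular wr v vr.
rewrite (max_gaussE vr) (max_gaussE wr).
apply: lee_wpmul2l; first by rewrite lee_fin expR_ge0.
(* Replacing [v] by [v'] keeps all norms, does not decrease the integral, and brings the origin into
   the convex hull. *)
have [v' [v'0 v'v v'le v'hull]] := spread_out v.
apply: (le_trans (exp_max_integral_polarize v'0 v'v v'le)).
apply: (@exp_max_integral_le_conv_hull _ _ w r) => // i.
case: (unliftP ord0 i) => [j|] ->; first by rewrite v'v vr.
by rewrite enormE v'0 -enormE vr.
Qed.
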